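(* Let $E$ be an uncountable closed subset of the unit circle $\mathbb{T}$. Then property $P(0,t,E)$ does not hold for any real $t\ge 0$.
   Context: For a closed set $E\subset\mathbb{T}$ and reals $s,t\ge 0$, property $P(s,t,E)$ is the following: every invertible bounded operator $T$ on a (complex) Banach space with spectrum $\mathrm{Sp}\,T\subset E$ satisfying $\|T^n\|=O(n^s)$ as $n\to+\infty$ and, for every $\varepsilon>0$, $\|T^{-n}\|=O(e^{\varepsilon\sqrt n})$ as $n\to+\infty$, also satisfies $\|T^{-n}\|=O(n^t)$ as $n\to+\infty$. *)

(* Defs.v *)
From mathcomp Require Import all_boot all_order all_algebra.
From mathcomp Require Import all_classical all_reals all_analysis.
From mathcomp Require Import complex.

Set Implicit Arguments.
Unset Strict Implicit.
Unset Printing Implicit Defensive.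

Import Order.TTheory GRing.Theory Num.Theory.
Import numFieldNormedType.Exports.

Local Open Scope classical_set_scope.
Local Open Scope ring_scope.

(* [R[i]] itself carries no declared topology; the topology and the normed
   structure defined by the modulus are found on the carrier of the
   [numFieldType] structure of [R[i]]. *)
Definition CC (R : realType) : numFieldType := R[i]%C.

Definition unit_circle {R : realType} : set (CC R) := [set z | `|z| = 1].

Section Operators.
Context {R : realType} {V : completeNormedModType (CC R)}.
Implicit Types T S : V -> V.

Definition bounded_op T : Prop := linear T /\ bounded_near T (nbhs (0 : V)).

Definition bounded_inverse T S : Prop :=
  [/\ bounded_op S, cancel T S & cancel S T].

Definition spectrum T : set (CC R) :=
  [set z | ~ exists S, bounded_inverse (fun x => T x - z *: x) S].

(* Norms in [V] are nonnegative real elements of [R[i]], whence [complex.Re]. *)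
Definition opnorm T : R :=
  sup [set complex.Re `|T x| | x in [set x : V | `|x| <= 1]].

End Operators.

(* [S] is the inverse of [T], so [iter n S] is the power [T^(-n)]. *)
Definition property_P (R : realType) (s t : R) (E : set (CC R)) : Prop :=
  forall (V : completeNormedModType (CC R)) (T S : V -> V),
    bounded_op T -> bounded_inverse T S -> spectrum T `<=` E ->
    (fun n : nat => opnorm (iter n T)) =O_\oo (fun n : nat => n%:R `^ s) ->
    (forall eps : R, 0 < eps ->
       (fun n : nat => opnorm (iter n S)) =O_\oo
       (fun n : nat => expR (eps * Num.sqrt n%:R))) ->
    (fun n : nat => opnorm (iter n S)) =O_\oo (fun n : nat => n%:R `^ t).

(* Main.v *)
(* Realize the operator on an ultraproduct-like space, the bounded families
   [(f_N)], [f_N] in [C ^ N] with the Euclidean norm, modulo the families with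
   [limsup `|f_N| = 0].  Take a sequence [x] in [E] which is a continuous
   injective image of the naturals for the 2-adic topology, approaching [x 0]
   quickly; it exists because an uncountable set has a perfect set of
   condensation points.  At level [N = 2 ^ k.+1] put
     [T = (r - L) (1 - r L)^-1 D],  [r = 1 - N^-1],
   where [L] is the shift and [D] the diagonal matrix of [x 0, ..., x N.-1]: a
   discretization of the model operator of the singular inner function of a
   continuous measure on [E].  [T] is a product of a contraction and a unitary.
   A first-order recursion computes [(T - z)^-1]: it involves only products of
   the factors [Q = (x_l - r z) / (r x_l - z)], where
     [`|Q| ^ 2 = 1 + (1 - r ^ 2) (1 - `|z| ^ 2) / `|r x_l - z| ^ 2].
   So it is bounded in [N] when [z] is off [E], and since any small disc contains
   a small proportion of the points [x_l], it is [exp (o (1 / (1 - `|z|)))] in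
   the disc; by Cauchy's estimate [T ^- n] is [exp (o (sqrt n))].  But along the
   radius of [x 0] the resolvent grows faster than any power of
   [1 / (1 - `|z|)], which excludes polynomial growth of [T ^- n]. *)

From HB Require Import structures.
Require Import Defs.
From mathcomp Require Import all_boot all_order all_algebra.
From mathcomp Require Import all_classical all_reals all_analysis.
From mathcomp Require Import complex.
From mathcomp Require Import cyclic cyclotomic separable.
From mathcomp Require Import ring lra.

Set Implicit Arguments.
Unset Strict Implicit.
Unset Printing Implicit Defensive.

Import Order.TTheory GRing.Theory Num.Theory.
Import numFieldNormedType.Exports.

Local Open Scope classical_set_scope.
Local Open Scope ring_scope.

(** * The Banach space of bounded families modulo null families *)

(** The order on [R[i]] is partial, so estimates are carried out on this real-valued form of the
    norm. *)
Definition rnorm {R : realType} {V : normedZmodType (CC R)} (x : V) : R :=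
  complex.Re `|x|.

Section RealNorm.
Variables (R : realType) (V : normedZmodType (CC R)).
Implicit Types x y : V.

Lemma rnormE x : `|x| = (rnorm x)%:C%C.
Proof.
have := normr_ge0 x; rewrite /rnorm; case: (`|x| : CC R) => a b.
by rewrite lecE /= => /andP[/eqP -> _].
Qed.

Lemma rnorm_ge0 x : 0 <= rnorm x.
Proof. by rewrite -lecR -rnormE normr_ge0. Qed.

Lemma rnorm0 : rnorm (0 : V) = 0.
Proof. by rewrite /rnorm normr0. Qed.

Lemma rnorm_eq0 x : rnorm x = 0 -> x = 0.
Proof. by move=> x0; apply/eqP; rewrite -normr_eq0 rnormE x0. Qed.

Lemma rnormD x y : rnorm (x + y) <= rnorm x + rnorm y.
Proof. by rewrite -lecR raddfD/= -!rnormE ler_normD. Qed.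

Lemma rnormN x : rnorm (- x) = rnorm x.
Proof. by rewrite /rnorm normrN. Qed.

Lemma rnormB x y : rnorm (x - y) <= rnorm x + rnorm y.
Proof. by rewrite -(rnormN y) rnormD. Qed.

Lemma rdistC x y : rnorm (x - y) = rnorm (y - x).
Proof. by rewrite -rnormN opprB. Qed.

Lemma rnorm_distB x y : rnorm x - rnorm y <= rnorm (x - y).
Proof. by rewrite lerBlDr -{1}(subrK y x) rnormD. Qed.

Lemma rnorm_le x (c : R) : (rnorm x <= c) = (`|x| <= c%:C%C).
Proof. by rewrite rnormE lecR. Qed.

Lemma rnorm_lt x (c : R) : (rnorm x < c) = (`|x| < c%:C%C).
Proof. by rewrite rnormE ltcR. Qed.

End RealNorm.

Section RealNormComplex.
Variable R : realType.
Implicit Types x y : CC R.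

Lemma rnormZ (V : normedModType (CC R)) x (v : V) :
  rnorm (x *: v) = rnorm x * rnorm v.
Proof.
apply: complexI; rewrite rmorphM/= -!rnormE; exact: normrZ.
Qed.

Lemma rnormM x y : rnorm (x * y) = rnorm x * rnorm y.
Proof. by apply: complexI; rewrite rmorphM/= -!rnormE normrM. Qed.

Lemma rnorm1 : rnorm (1 : CC R) = 1.
Proof. by rewrite /rnorm normr1. Qed.

Lemma rnormX x n : rnorm (x ^+ n) = rnorm x ^+ n.
Proof. by elim: n => [|n IHn]; rewrite ?rnorm1// !exprS rnormM IHn. Qed.

Lemma rnormV x : rnorm x^-1 = (rnorm x)^-1.
Proof. by apply: complexI; rewrite fmorphV/= -!rnormE normfV. Qed.

Lemma rnorm_real (a : R) : rnorm (a%:C%C : CC R) = `|a|.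
Proof. by rewrite /rnorm normc_def/= expr0n addr0 sqrtr_sqr. Qed.

Lemma rnorm_prod (I : Type) (s : seq I) (P : pred I) (F : I -> CC R) :
  rnorm (\prod_(i <- s | P i) F i) = \prod_(i <- s | P i) rnorm (F i).
Proof. by elim/big_rec2: _ => [|i a b _ <-]; rewrite ?rnorm1 ?rnormM. Qed.

Lemma rnorm_sqr x : rnorm x ^+ 2 = complex.Re x ^+ 2 + complex.Im x ^+ 2.
Proof.
by rewrite /rnorm normc_def/= sqr_sqrtr// addr_ge0// sqr_ge0.
Qed.

End RealNormComplex.

(** One seminorm per level, all on a single vector space: a family indexed by the levels is then a
    plain function [nat -> U], without dependent types. A seminorm suffices, since level [k] may
    ignore part of [U]. *)
Record seminorms (R : realType) (U : lmodType (CC R)) := Seminorms {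
  sn :> nat -> U -> R;
  snD : forall k u v, sn k (u + v) <= sn k u + sn k v;
  snZ : forall k a u, sn k (a *: u) = rnorm a * sn k u }.

Section SeminormTheory.
Variables (R : realType) (U : lmodType (CC R)) (p : seminorms U).


Lemma sn0 k : p k 0 = 0.
Proof. by rewrite -(scale0r 0) snZ rnorm0 mul0r. Qed.

Lemma snN k u : p k (- u) = p k u.
Proof. by rewrite -scaleN1r snZ rnormN rnorm1 mul1r. Qed.

Lemma sn_ge0 k u : 0 <= p k u.
Proof.
have := snD p k u (- u); rewrite subrr sn0 snN.
by rewrite -mulr2n pmulrn_lge0.
Qed.

Lemma snB k u v : p k (u - v) <= p k u + p k v.
Proof. by rewrite -(snN k v) snD. Qed.

Lemma sn_dist k u v : p k u - p k v <= p k (u - v).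
Proof. by rewrite lerBlDr -{1}(subrK v u) snD. Qed.

(** Boundedness is asked only for large [k], because the resolvents below are controlled only from
    some level on, which depends on the spectral parameter. *)
Definition sbounded : pred (nat -> U) :=
  fun f => `[< exists M, \forall k \near \oo, p k (f k) <= M >].

Lemma sbounded_submod : submod_closed sbounded.
Proof.
split; first by apply/asboolP; exists 0; near=> k; rewrite sn0.
move=> a f g /asboolP[M fM] /asboolP[N gN]; apply/asboolP.
exists (rnorm a * M + N); near=> k.
rewrite (le_trans (snD p k _ _))// lerD//; last by near: k.
by rewrite snZ ler_wpM2l ?rnorm_ge0//; near: k.
Unshelve. all: by end_near. Qed.

HB.instance Definition _ :=
  GRing.isSubmodClosed.Build (CC R) (nat -> U) sbounded sbounded_submod.

Definition sbdd := {f : nat -> U | f \in sbounded}.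
HB.instance Definition _ := SubChoice.on sbdd.
HB.instance Definition _ := [SubChoice_isSubLmodule of sbdd by <:].

Definition snull : pred sbdd :=
  fun f => `[< forall e, 0 < e -> \forall k \near \oo, p k (val f k) <= e >].

Lemma snull_zmod : zmod_closed snull.
Proof.
split.
  by apply/asboolP => e e0; near=> k; rewrite /= sn0 ltW.
move=> f g /asboolP f0 /asboolP g0; apply/asboolP => e e0.
have e20 : 0 < e / 2 by rewrite divr_gt0.
near=> k; rewrite (splitr e) (le_trans (snB k _ _))// lerD//.
  by near: k; exact: f0.
by near: k; exact: g0.
Unshelve. all: by end_near. Qed.

HB.instance Definition _ := GRing.isZmodClosed.Build sbdd snull snull_zmod.
(** The quotient is taken as an additive group; scalars and norm are then defined through
    representatives and shown independent of the choice. *)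
Definition hull := Quotient.quot (Algebra.ZmodClosed.clone sbdd snull _).
HB.instance Definition _ := GRing.Zmodule.on hull.
HB.instance Definition _ := EqQuotient.on hull.

Local Open Scope quotient_scope.

Definition hcls (f : sbdd) : hull := \pi_hull f.
Definition hrep (x : hull) : sbdd := repr x.

Lemma hrepK x : hcls (hrep x) = x. Proof. exact: reprK. Qed.

Lemma hclsD f g : hcls (f + g) = hcls f + hcls g.
Proof. exact: Quotient.pi_add. Qed.

Lemma hclsN f : hcls (- f) = - hcls f.
Proof. exact: Quotient.pi_opp. Qed.

Lemma hcls0 : hcls 0 = 0.
Proof. by apply: (addrI (hcls 0)); rewrite -hclsD !addr0. Qed.

Lemma hcls_eq f g : hcls f = hcls g <->
  forall e, 0 < e -> \forall k \near \oo, p k (val f k - val g k) <= e.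
Proof.
split.
  by move=> /eqP; rewrite -Quotient.idealrBE => /asboolP.
move=> fg; apply/eqP; rewrite -Quotient.idealrBE.
by apply/asboolP => e e0; exact: fg.
Qed.

Lemma hrep_cls f e : 0 < e ->
  \forall k \near \oo, p k (val (hrep (hcls f)) k - val f k) <= e.
Proof. by move: e; apply/hcls_eq; rewrite hrepK. Qed.

Definition hull_scale (a : CC R) (x : hull) : hull := hcls (a *: hrep x).

Lemma hull_scaleE a f : hull_scale a (hcls f) = hcls (a *: f).
Proof.
apply/hcls_eq => e e0 /=.
have a0 : 0 < rnorm a + 1 by rewrite ltr_wpDl// rnorm_ge0.
near=> k.
rewrite -scalerBr snZ.
have : p k (val (hrep (hcls f)) k - val f k) <= e / (rnorm a + 1).
  by near: k; apply: hrep_cls; rewrite divr_gt0.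
move=> /(ler_wpM2l (rnorm_ge0 a)) /le_trans; apply.
by rewrite mulrCA ger_pMr// ler_pdivrMr// mul1r lerDl.
Unshelve. all: by end_near. Qed.

Fact hull_scaleA a b x : hull_scale a (hull_scale b x) = hull_scale (a * b) x.
Proof. by rewrite -[x]hrepK !hull_scaleE scalerA. Qed.

Fact hull_scale1 : left_id 1 hull_scale.
Proof. by move=> x; rewrite -[x]hrepK !hull_scaleE scale1r. Qed.

Fact hull_scaleDr : right_distributive hull_scale +%R.
Proof.
move=> a x y; rewrite -[x]hrepK -[y]hrepK -hclsD !hull_scaleE -hclsD.
by rewrite scalerDr.
Qed.

Fact hull_scaleDl x : {morph hull_scale^~ x : a b / a + b}.
Proof.
by move=> a b /=; rewrite -[x]hrepK !hull_scaleE -hclsD scalerDl.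
Qed.

HB.instance Definition _ := GRing.Zmodule_isLmodule.Build (CC R) hull
  hull_scaleA hull_scale1 hull_scaleDr hull_scaleDl.

Lemma hclsZ a f : hcls (a *: f) = a *: hcls f.
Proof. by rewrite -hull_scaleE. Qed.

Definition limsup_sn (f : nat -> U) : R :=
  inf [set M | \forall k \near \oo, p k (f k) <= M].

Lemma limsup_sn_has_inf (f : sbdd) :
  has_inf [set M | \forall k \near \oo, p k (val f k) <= M].
Proof.
split; first by have /asboolP[M fM] := valP f; exists M.
exists 0 => M [k _ /(_ k (leqnn k)) /=]; apply: le_trans; exact: sn_ge0.
Qed.

Lemma limsup_sn_le (f : sbdd) M : (\forall k \near \oo, p k (val f k) <= M) ->
  limsup_sn (val f) <= M.
Proof. by move=> fM; apply: ge_inf => //; have [] := limsup_sn_has_inf f. Qed.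

Lemma limsup_sn_near (f : sbdd) M : limsup_sn (val f) < M ->
  \forall k \near \oo, p k (val f k) <= M.
Proof.
move=> /(inf_lt (limsup_sn_has_inf f).1)[N /= fN NM].
near=> k; rewrite (le_trans _ (ltW NM))//; near: k; exact: fN.
Unshelve. all: by end_near. Qed.

Lemma limsup_sn_le_trans (f g : sbdd) :
  (forall e, 0 < e -> \forall k \near \oo, p k (val f k) <= p k (val g k) + e) ->
  limsup_sn (val f) <= limsup_sn (val g).
Proof.
move=> fg; apply/ler_addgt0Pl => e e0; apply: limsup_sn_le.
have e20 : 0 < e / 2 by rewrite divr_gt0.
near=> k.
have h : p k (val g k) <= e / 2 + limsup_sn (val g).
  by near: k; apply: limsup_sn_near; rewrite ltrDr.
have : p k (val f k) <= p k (val g k) + e / 2 by near: k; exact: fg.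
lra.
Unshelve. all: by end_near. Qed.

Lemma limsup_sn_eq (f g : sbdd) :
  (forall e, 0 < e -> \forall k \near \oo, p k (val f k - val g k) <= e) ->
  limsup_sn (val f) = limsup_sn (val g).
Proof.
move=> fg; apply/eqP; rewrite eq_le; apply/andP; split;
  apply: limsup_sn_le_trans => e /fg fge; near=> k.
  by rewrite -lerBlDl (le_trans (sn_dist _ _ _))//; near: k.
rewrite -lerBlDl (le_trans (sn_dist _ _ _))//.
by rewrite -snN opprB; near: k.
Unshelve. all: by end_near. Qed.

Definition hull_norm (x : hull) : CC R := (limsup_sn (val (hrep x)))%:C%C.

Lemma hull_normE f : hull_norm (hcls f) = (limsup_sn (val f))%:C%C.
Proof. by congr (_%:C)%C; apply: limsup_sn_eq => e; exact: hrep_cls. Qed.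

Fact hull_normD x y : hull_norm (x + y) <= hull_norm x + hull_norm y.
Proof.
rewrite -[x]hrepK -[y]hrepK; move: (hrep x) (hrep y) => f g.
rewrite -hclsD !hull_normE -raddfD lecR.
apply/ler_addgt0Pl => e e0; apply: limsup_sn_le.
have e20 : 0 < e / 2 by rewrite divr_gt0.
near=> k; rewrite (le_trans (snD p k _ _))//.
have : p k (val f k) <= e / 2 + limsup_sn (val f).
  by near: k; apply: limsup_sn_near; rewrite ltrDr.
have : p k (val g k) <= e / 2 + limsup_sn (val g).
  by near: k; apply: limsup_sn_near; rewrite ltrDr.
by move=> /= *; lra.
Unshelve. all: by end_near. Qed.

Lemma limsup_snZ_le a (f : sbdd) :
  limsup_sn (val (a *: f)) <= rnorm a * limsup_sn (val f).
Proof.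
apply/ler_addgt0Pl => e e0; apply: limsup_sn_le.
have a0 : 0 < rnorm a + 1 by rewrite ltr_wpDl// rnorm_ge0.
near=> k; rewrite /= snZ.
have /(ler_wpM2l (rnorm_ge0 a)) : p k (val f k) <= e / (rnorm a + 1) + limsup_sn (val f).
  by near: k; apply: limsup_sn_near; rewrite ltrDr divr_gt0.
move=> /le_trans; apply.
rewrite mulrDr lerD2r mulrCA ger_pMr// ler_pdivrMr// mul1r lerDl//.
Unshelve. all: by end_near. Qed.

Fact hull_normZ a x : hull_norm (a *: x) = `|a| * hull_norm x.
Proof.
rewrite -[x]hrepK; move: (hrep x) => f.
rewrite -hclsZ !hull_normE rnormE -rmorphM; congr (_%:C)%C.
apply/eqP; rewrite eq_le limsup_snZ_le/=.
have [->|a0] := eqVneq a 0.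
  rewrite rnorm0 mul0r scale0r; apply/ler_addgt0Pl => e e0.
  have /limsup_sn_near [k _ /(_ k (leqnn k)) h] :
    limsup_sn (val (0 : sbdd)) < e + limsup_sn (val (0 : sbdd)) by rewrite ltrDr.
  by rewrite (le_trans _ h)// sn_ge0.
have ra : 0 < rnorm a by rewrite lt_def rnorm_ge0 andbT; apply: contra_neq a0 => /rnorm_eq0.
(* The reverse inequality is the first one applied to the inverse scalar. *)
have := limsup_snZ_le a^-1 (a *: f).
by rewrite scalerA mulVf// scale1r rnormV -ler_pdivrMl ?invr_gt0// invrK.
Qed.

Fact hull_norm_eq0 x : hull_norm x = 0 -> x = 0.
Proof.
rewrite -[x]hrepK; move: (hrep x) => f; rewrite hull_normE => /complexI f0.
rewrite -hcls0.
apply/hcls_eq => e e0; near=> k.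
by rewrite subr0; near: k; apply: limsup_sn_near; rewrite f0.
Unshelve. all: by end_near. Qed.

HB.instance Definition _ := Lmodule_isNormed.Build (CC R) hull
  hull_normD hull_normZ hull_norm_eq0.

Lemma rnorm_hcls f : rnorm (hcls f) = limsup_sn (val f).
Proof. by rewrite /rnorm [`|_|]hull_normE. Qed.

End SeminormTheory.

Lemma posC_real (R : realType) (e : CC R) : 0 < e ->
  exists2 d : R, 0 < d & e = d%:C%C.
Proof.
case: e => a b; rewrite ltcE /= => /andP[/eqP -> a0]; by exists a.
Qed.

Section HullComplete.
Variables (R : realType) (U : lmodType (CC R)) (p : seminorms U).
Local Notation hull := (hull p).

(** Diagonal argument. At level [k] take the member of index [m k], the largest index up to [k] for
    which the Cauchy estimates among all earlier members already hold at level [k]. Each estimate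
    holds from some level on, so [m k] tends to infinity. *)
Lemma diagonal_sbdd (f : nat -> sbdd p) :
  (forall i j, \forall k \near \oo,
    p k (val (f i) k - val (f j) k) <= 2^-1 ^+ i + 2^-1 ^+ j) ->
  exists g : sbdd p, forall i,
    \forall k \near \oo, p k (val (f i) k - val g k) <= 2^-1 ^+ i + 2^-1 ^+ i.
Proof.
move=> fcauchy.
pose P k m := all (fun i => all (fun j =>
  p k (val (f i) k - val (f j) k) <= 2^-1 ^+ i + 2^-1 ^+ j) (iota 0 m.+1))
  (iota 0 m.+1).
have allP_near (s : seq nat) (Q : nat -> nat -> bool) :
    (forall a, \forall k \near \oo, Q k a) -> \forall k \near \oo, all (Q k) s.
  move=> QP; elim: s => [|a s IHs]; first by near=> k.
  by near=> k => /=; apply/andP; split; near: k.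
pose m k := \max_(i < k.+1 | P k i) i.
have mP k : P k (m k).
  have P0 : P k (@ord0 k).
    by rewrite /P /= subrr sn0 addr_ge0// exprn_ge0.
  rewrite /m (bigop.bigmax_eq_arg (@ord0 k))//.
  by case: arg_maxnP.
have m_ge i : \forall k \near \oo, (i <= m k)%N.
  have : \forall k \near \oo, P k i.
    by apply: (allP_near _ _) => a; apply: (allP_near _ _) => b; exact: fcauchy.
  move=> Pi; near=> k.
  have ik : (i < k.+1)%N by rewrite ltnS; near: k; exact: nbhs_infty_ge.
  apply: (leq_bigmax_cond (Ordinal ik)) => /=; near: k; exact: Pi.
have gP i : \forall k \near \oo,
    p k (val (f i) k - val (f (m k)) k) <= 2^-1 ^+ i + 2^-1 ^+ i.
  near=> k.
  have im : (i <= m k)%N by near: k; exact: m_ge.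
  have /allP/(_ i) := mP k; rewrite mem_iota ltnS => /(_ im) /allP /(_ (m k)).
  rewrite mem_iota ltnS leqnn => /(_ isT) /le_trans; apply.
  by rewrite lerD2l ler_wiXn2l// invf_le1// ler1n.
have gb : (fun k => val (f (m k)) k) \in sbounded p.
  have /asboolP[M fM] := valP (f 0%N).
  apply/asboolP; exists (M + 2); near=> k.
  have : p k (val (f 0%N) k) <= M by near: k.
  have : p k (val (f 0%N) k - val (f (m k)) k) <= 2^-1 ^+ 0 + 2^-1 ^+ 0.
    by near: k; exact: gP.
  have := sn_dist p k (val (f (m k)) k) (val (f 0%N) k).
  rewrite -(snN p k (_ - _)) opprB expr0; lra.
by exists (exist (fun h => h \in sbounded p) _ gb).
Unshelve. all: by end_near. Qed.

(** The filter contains balls of radius [2^-1 ^+ i] around points [x i]. Any two of these balls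
    meet, which gives the Cauchy estimates of [diagonal_sbdd]; the diagonal family is the limit. *)
Lemma hull_complete (F : set_system hull) :
  ProperFilter F -> cauchy F -> cvg F.
Proof.
move=> FF /cauchyP Fc.
have pow0 i : 0 < (2^-1 ^+ i : R) by rewrite exprn_gt0.
have /choice [x xF] : forall i, exists x : hull, F (ball x (2^-1 ^+ i)%:C%C).
  by move=> i; apply: Fc; rewrite ltcR.
have [g gP] : exists g : sbdd p, forall i,
    \forall k \near \oo, p k (val (hrep (x i)) k - val g k) <= 2^-1 ^+ i + 2^-1 ^+ i.
  apply: diagonal_sbdd => i j.
  suff : limsup_sn p (val (hrep (x i) - hrep (x j))) < 2^-1 ^+ i + 2^-1 ^+ j.
    exact: limsup_sn_near.
  have [y [yi yj]] := filter_ex (filterI (xF i) (xF j)).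
  rewrite -rnorm_hcls hclsD hclsN !hrepK.
  move: yi yj; rewrite -!ball_normE /= -!rnorm_lt => yi yj.
  have := rnormD (x i - y) (y - x j); rewrite subrKA => /le_lt_trans; apply.
  by rewrite ltrD// rdistC.
apply/cvg_ex; exists (hcls g).
apply/cvg_ballP => _ /posC_real[e e0 ->].
have [i ie] : exists i, 3 * 2^-1 ^+ i < e.
  have [i _ /(_ i (leqnn i)) /=] :=
    near_infty_natSinv_expn_lt (PosNum (divr_gt0 e0 (ltr0n R 3))).
  by rewrite div1r -exprVn ltr_pdivlMr// mulrC => ?; exists i.
near=> y.
rewrite -ball_normE /= -rnorm_lt.
have yi : rnorm (x i - y) < 2^-1 ^+ i.
  by rewrite rnorm_lt; near: y; have := xF i; rewrite -ball_normE.
have xg : rnorm (hcls g - x i) <= 2^-1 ^+ i + 2^-1 ^+ i.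
  rewrite rdistC -[x i]hrepK -hclsN -hclsD rnorm_hcls; apply: limsup_sn_le.
  exact: gP.
have := rnormD (hcls g - x i) (x i - y); rewrite subrKA => /le_lt_trans; apply.
lra.
Unshelve. all: by end_near. Qed.

HB.instance Definition _ := Uniform_isComplete.Build hull hull_complete.

End HullComplete.

(** * Operators acting level by level on the quotient *)

Section HullOperators.
Variables (R : realType) (U : lmodType (CC R)) (p : seminorms U).
Local Notation hull := (hull p).
Implicit Types (f : nat -> U) (x : hull) (T S : nat -> U -> U).

(** The default 0 of [insubd] makes this total on all families; it is the class of [f] when [f] is
    bounded. *)
Definition mkhull f : hull := hcls (insubd (0 : sbdd p) f).

Lemma mkhullE f (fb : f \in sbounded p) : mkhull f = hcls (exist (fun h => h \in sbounded p) f fb).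
Proof.
rewrite /mkhull; congr hcls; apply: val_inj; rewrite val_insubd fb//.
Qed.

Lemma mkhull_repr x : mkhull (val (hrep x)) = x.
Proof. by rewrite /mkhull valKd hrepK. Qed.

Lemma mkhull_le f (c : R) : (\forall k \near \oo, p k (f k) <= c) ->
  rnorm (mkhull f) <= c.
Proof.
move=> fc; have fb : f \in sbounded p by apply/asboolP; exists c.
by rewrite mkhullE rnorm_hcls; exact: limsup_sn_le.
Qed.

Lemma mkhull_ge f (c : R) : f \in sbounded p ->
  (\forall k \near \oo, c <= p k (f k)) -> c <= rnorm (mkhull f).
Proof.
move=> fb cf; rewrite mkhullE rnorm_hcls.
apply/ler_addgt0Pl => e e0; near \oo => k.
rewrite (@le_trans _ _ (p k (f k)))//; first by near: k.
near: k; apply: (@limsup_sn_near _ _ _ (exist (fun h => h \in sbounded p) f fb : sbdd p)).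
by rewrite ltrDr.
Unshelve. all: by end_near. Qed.

Definition ubounded T (c : R) : Prop :=
  (forall k, linear (T k)) /\
  \forall k \near \oo, forall u, p k (T k u) <= c * p k u.

Definition hull_map T x : hull := mkhull (fun k => T k (val (hrep x) k)).

Lemma ubounded_sbounded T c f : ubounded T c -> f \in sbounded p ->
  (fun k => T k (f k)) \in sbounded p.
Proof.
move=> [_ Tc] /asboolP[M fM]; apply/asboolP; exists (`|c| * M).
near=> k.
have Tk : p k (T k (f k)) <= c * p k (f k) by near: k; apply: filterS Tc.
have fk : p k (f k) <= M by near: k.
rewrite (le_trans Tk)// (le_trans (ler_wpM2r _ (ler_norm c)))// ?sn_ge0//.
by rewrite ler_wpM2l.
Unshelve. all: by end_near. Qed.

(** Independence of the representative: a uniform bound on the [T k] sends null families to null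
    families. *)
Lemma hull_mapE T c f : ubounded T c -> f \in sbounded p ->
  hull_map T (mkhull f) = mkhull (fun k => T k (f k)).
Proof.
move=> Tc fb; rewrite /hull_map (mkhullE fb).
set g := hrep _.
have Tg := ubounded_sbounded Tc (valP g); have Tf := ubounded_sbounded Tc fb.
rewrite (mkhullE Tg) (mkhullE Tf); apply/hcls_eq => e e0 /=.
have [Tlin Tb] := Tc.
have c0 : 0 < `|c| + 1 by rewrite ltr_wpDl.
near=> k.
have -> : T k (val g k) - T k (f k) = T k (val g k - f k).
  pose L := GRing.isLinear.Build _ _ _ _ (T k) (Tlin k).
  pose TL : {linear U -> U} := HB.pack (T k) L.
  by rewrite -[T k]/(TL : U -> U) linearB.
have Tk : p k (T k (val g k - f k)) <= c * p k (val g k - f k).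
  by near: k; apply: filterS Tb.
have gk : p k (val g k - f k) <= e / (`|c| + 1).
  near: k; apply: (@hrep_cls _ _ _ (exist (fun h => h \in sbounded p) f fb : sbdd p)).
  by rewrite divr_gt0.
rewrite (le_trans Tk)// (le_trans (ler_wpM2r _ (ler_norm c)))// ?sn_ge0//.
rewrite (le_trans (ler_wpM2l _ gk))//.
by rewrite mulrCA ger_pMr// ler_pdivrMr// mul1r lerDl.
Unshelve. all: by end_near. Qed.

Lemma hull_map_comp T S c d x : ubounded T c -> ubounded S d ->
  hull_map T (hull_map S x) = hull_map (fun k => T k \o S k) x.
Proof.
move=> Tc Sd; rewrite {2}/hull_map (hull_mapE Tc)//.
by apply: ubounded_sbounded Sd _; exact: valP.
Qed.

Lemma hull_map_id x : hull_map (fun k => id) x = x.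
Proof. exact: mkhull_repr. Qed.

Lemma mkhull_linear a f g : f \in sbounded p -> g \in sbounded p ->
  mkhull (fun k => a *: f k + g k) = a *: mkhull f + mkhull g.
Proof.
move=> fb gb; have fgb : (fun k => a *: f k + g k) \in sbounded p.
  by have [_ ->] := sbounded_submod p.
rewrite (mkhullE fb) (mkhullE gb) (mkhullE fgb) -hclsZ -hclsD.
by congr hcls; apply: val_inj.
Qed.

Lemma hull_map_linear T c : ubounded T c -> linear (hull_map T).
Proof.
move=> Tc a x y.
have xb := valP (hrep x); have yb := valP (hrep y).
have Tx := ubounded_sbounded Tc xb; have Ty := ubounded_sbounded Tc yb.
have [_ /(_ a _ _ xb yb) xyb] := sbounded_submod p.
rewrite -[x]mkhull_repr -[y]mkhull_repr -(mkhull_linear a xb yb).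
rewrite (hull_mapE Tc xyb) (hull_mapE Tc xb) (hull_mapE Tc yb).
rewrite -(mkhull_linear a Tx Ty); congr mkhull; apply/funext => k.
by have [Tlin _] := Tc; rewrite Tlin.
Qed.

Lemma hull_map_le T c x : ubounded T c -> 0 <= c ->
  rnorm (hull_map T x) <= c * rnorm x.
Proof.
move=> [_ Tc] c0; rewrite -{2}[x]hrepK rnorm_hcls.
have c1 : 0 < c + 1 by rewrite ltr_wpDl.
apply/ler_addgt0Pl => e e0; apply: mkhull_le; near=> k.
have Tk : p k (T k (val (hrep x) k)) <= c * p k (val (hrep x) k).
  by near: k; apply: filterS Tc.
rewrite (le_trans Tk)//.
have : p k (val (hrep x) k) <= e / (c + 1) + limsup_sn p (val (hrep x)).
  by near: k; apply: limsup_sn_near; rewrite ltrDr divr_gt0.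
move=> /(ler_wpM2l c0) /le_trans; apply.
by rewrite mulrDr lerD2r mulrCA ger_pMr// ler_pdivrMr// mul1r lerDl.
Unshelve. all: by end_near. Qed.

End HullOperators.

(** * The operators on finite levels and their resolvents *)

Section EuclideanSeminorm.
Variable R : realType.
Implicit Types f g : nat -> CC R.

Definition l2norm (N : nat) f : R := Num.sqrt (\sum_(l < N) rnorm (f l) ^+ 2).

Lemma l2norm_ge0 N f : 0 <= l2norm N f. Proof. exact: sqrtr_ge0. Qed.

Lemma l2norm_sqr N f : l2norm N f ^+ 2 = \sum_(l < N) rnorm (f l) ^+ 2.
Proof. by rewrite sqr_sqrtr// sumr_ge0// => i _; rewrite sqr_ge0. Qed.

Lemma l2norm_sqrS N f :
  l2norm N.+1 f ^+ 2 = l2norm N f ^+ 2 + rnorm (f N) ^+ 2.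
Proof. by rewrite !l2norm_sqr big_ord_recr. Qed.

Lemma l2norm_le N f c : 0 <= c -> (l2norm N f <= c) = (l2norm N f ^+ 2 <= c ^+ 2).
Proof. by move=> c0; rewrite ler_pXn2r// nnegrE l2norm_ge0. Qed.

Lemma l2normD N f g : l2norm N (f + g) <= l2norm N f + l2norm N g.
Proof.
elim: N => [|N IHN]; first by rewrite /l2norm !big_ord0 sqrtr0 addr0.
(* Minkowski's inequality in the plane, reduced by Lagrange's identity to Cauchy-Schwarz; it carries
   the induction on the dimension. *)
have le2D (a b c d A B : R) : 0 <= A -> 0 <= B -> A ^+ 2 = a ^+ 2 + c ^+ 2 ->
    B ^+ 2 = b ^+ 2 + d ^+ 2 -> (a + b) ^+ 2 + (c + d) ^+ 2 <= (A + B) ^+ 2.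
  move=> A0 B0 AE BE.
  suff : a * b + c * d <= A * B by nra.
  have : (a * b + c * d) ^+ 2 <= (A * B) ^+ 2.
    rewrite exprMn AE BE -subr_ge0.
    have -> : (a ^+ 2 + c ^+ 2) * (b ^+ 2 + d ^+ 2) - (a * b + c * d) ^+ 2 =
      (a * d - b * c) ^+ 2 by ring.
    exact: sqr_ge0.
  rewrite -(real_normK (num_real (a * b + c * d))) ler_pXn2r ?nnegrE ?mulr_ge0// => /(le_trans (ler_norm _)); exact.
rewrite l2norm_le ?addr_ge0 ?l2norm_ge0// l2norm_sqrS.
apply: le_trans (le2D _ _ _ _ _ _ (l2norm_ge0 N.+1 f) (l2norm_ge0 N.+1 g)
  (l2norm_sqrS N f) (l2norm_sqrS N g)).
by rewrite lerD// ler_pXn2r ?nnegrE ?addr_ge0 ?l2norm_ge0 ?rnorm_ge0// rnormD.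
Qed.

Lemma l2normZ N a f : l2norm N (a *: f) = rnorm a * l2norm N f.
Proof.
apply/eqP; rewrite -(@eqrXn2 _ 2)// ?mulr_ge0 ?l2norm_ge0 ?rnorm_ge0//.
rewrite exprMn !l2norm_sqr mulr_sumr; apply/eqP/eq_bigr => l _.
by rewrite -exprMn -rnormM.
Qed.

Definition l2seminorms (N : nat -> nat) : seminorms (nat -> CC R) :=
  Seminorms (fun k => l2normD (N k)) (fun k => l2normZ (N k)).

Lemma l2norm_mono N f g : (forall l, (l < N)%N -> rnorm (f l) <= rnorm (g l)) ->
  l2norm N f <= l2norm N g.
Proof.
move=> fg; rewrite ler_wsqrtr// ler_sum// => l _.
by rewrite ler_pXn2r ?nnegrE ?rnorm_ge0// fg.
Qed.

Lemma l2norm_sup N f c : 0 <= c -> (forall l, (l < N)%N -> rnorm (f l) <= c) ->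
  l2norm N f <= Num.sqrt N%:R * c.
Proof.
move=> c0 fc; rewrite l2norm_le ?mulr_ge0 ?sqrtr_ge0// l2norm_sqr.
rewrite exprMn sqr_sqrtr// mulr_natl.
rewrite (le_trans (ler_sum (G := fun=> c ^+ 2) _ _))//; last first.
  by rewrite sumr_const card_ord.
by move=> l _; rewrite ler_pXn2r ?nnegrE ?rnorm_ge0// fc.
Qed.

(** Cauchy-Schwarz against the constant vector 1. *)
Lemma sum_l2norm N f :
  \sum_(l < N) rnorm (f l) <= Num.sqrt N%:R * l2norm N f.
Proof.
have S0 M : 0 <= \sum_(l < M) rnorm (f l).
  by rewrite sumr_ge0// => i _; exact: rnorm_ge0.
rewrite -(ler_pXn2r (n := 2))// ?nnegrE ?mulr_ge0 ?sqrtr_ge0 ?S0//.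
rewrite exprMn sqr_sqrtr// l2norm_sqr.
elim: N => [|N IHN]; first by rewrite !big_ord0 expr0n/= mulr0.
rewrite !big_ord_recr/=; have := S0 N; move: IHN.
set S := \sum_(_ < _) _; set Q := \sum_(_ < _) _; set a := rnorm _ => IHN S0N.
have Q0 : 0 <= Q by rewrite sumr_ge0// => i _; rewrite sqr_ge0.
suff : 2 * S * a <= Q + N%:R * a ^+ 2 by rewrite -natr1; nra.
case: (posnP N) => [N0|N0].
  move: IHN; rewrite N0 mul0r => S2; have -> : S = 0.
    by apply/eqP; rewrite -sqrf_eq0 eq_le sqr_ge0 S2.
  by rewrite mulr0 mul0r mul0r addr0.
have N1 : 0 < (N%:R : R) by rewrite ltr0n.
rewrite -(ler_pM2l N1); have : 0 <= (S - N%:R * a) ^+ 2 by rewrite sqr_ge0.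
nra.
Qed.

End EuclideanSeminorm.

Section CayleyProduct.
Variables (R : realType) (r : R) (x : nat -> CC R).
Implicit Types f g : nat -> CC R.
Local Notation rC := (r%:C%C : CC R).

(** Coordinate [l] of [L (1 - r L)^-1 D f], that is, the sum over [m < l] of
    [r ^ (l - 1 - m) x_m f_m]. It enters [cayley] through [(r - L) (1 - r L)^-1 = r - (1 - r ^ 2) L
    (1 - r L)^-1]. *)
Fixpoint geomsum f l : CC R :=
  if l is l'.+1 then x l' * f l' + rC * geomsum f l' else 0.

(* The matrix of [(r - L) (1 - r L)^-1 D] where [L] is the shift
   [f l |-> f l.-1] and [D] the diagonal operator of entries [x]. *)
Definition cayley f l : CC R :=
  rC * x l * f l - (1 - rC ^+ 2) * geomsum f l.

(** Diagonal entry of the lower triangular matrix [T - z]. *)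
Definition pole z l : CC R := rC * x l - z.
Definition stepratio z l : CC R := (x l - rC * z) / pole z l.

(** Forward substitution in [(T - z) f = g]: this is [(1 - r ^ 2) * geomsum f l] for the solution
    [f], computed from [g] alone. Eliminating [f l] from the recursion of [geomsum] produces the
    factor [stepratio]. *)
Fixpoint restail z g l : CC R :=
  if l is l'.+1 then
    stepratio z l' * restail z g l' + (1 - rC ^+ 2) * x l' / pole z l' * g l'
  else 0.

Definition resolvent z g l : CC R := (restail z g l + g l) / pole z l.

Lemma linear_eval a f g l : (a *: f + g) l = a * f l + g l.
Proof. by []. Qed.

Lemma subZ_eval z f g l : (f - z *: g) l = f l - z * g l.
Proof. by []. Qed.

Lemma geomsum_linear l a f g :
  geomsum (a *: f + g) l = a * geomsum f l + geomsum g l.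
Proof.
elim: l => [|l IHl] /=; first by rewrite mulr0 addr0.
by rewrite IHl linear_eval; ring.
Qed.

Lemma cayley_linear : linear cayley.
Proof.
move=> a f g; apply/funext => l; rewrite linear_eval /cayley geomsum_linear linear_eval.
by ring.
Qed.

Lemma restail_linear z l a f g :
  restail z (a *: f + g) l = a * restail z f l + restail z g l.
Proof.
elim: l => [|l IHl] /=; first by rewrite mulr0 addr0.
by rewrite IHl linear_eval; ring.
Qed.

Lemma resolvent_linear z : linear (resolvent z).
Proof.
move=> a f g; apply/funext => l; rewrite linear_eval /resolvent restail_linear linear_eval.
by ring.
Qed.

Lemma restail_resolvent z g l : (forall l, pole z l != 0) ->
  restail z g l = (1 - rC ^+ 2) * geomsum (resolvent z g) l.
Proof.
move=> p0; elim: l => [|l IHl] /=; first by rewrite mulr0.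
rewrite mulrDr (mulrCA _ rC) -IHl /resolvent /stepratio.
have := p0 l; rewrite /pole => pl; field.
by rewrite -/(pole z l) p0.
Qed.

Lemma resolventK z g : (forall l, pole z l != 0) ->
  cayley (resolvent z g) - z *: resolvent z g = g.
Proof.
move=> p0; apply/funext => l.
rewrite subZ_eval /cayley.
rewrite -restail_resolvent// addrAC -mulrBl /resolvent mulrC divfK//.
by rewrite addrC addKr.
Qed.

Lemma restail_cayley z f l : (forall l, pole z l != 0) ->
  restail z (cayley f - z *: f) l = (1 - rC ^+ 2) * geomsum f l.
Proof.
move=> p0; elim: l => [|l IHl] /=; first by rewrite mulr0.
rewrite IHl /stepratio subZ_eval /cayley.
have := p0 l; rewrite /pole => pl; field.
by rewrite -/(pole z l) p0.
Qed.

Lemma cayleyK z f : (forall l, pole z l != 0) ->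
  resolvent z (cayley f - z *: f) = f.
Proof.
move=> p0; apply/funext => l; rewrite /resolvent restail_cayley//.
rewrite subZ_eval /cayley.
have := p0 l; rewrite /pole => pl; field.
by rewrite -/(pole z l) p0.
Qed.

Hypothesis x1 : forall m, rnorm (x m) = 1.
Hypothesis r01 : 0 < r < 1.

Lemma defect_gt0 : 0 < 1 - r ^+ 2.
Proof. by case/andP: r01 => r0 r1; rewrite subr_gt0 expr_lt1// ltW. Qed.

(** With [d ^ 2 = 1 - r ^ 2], passing coordinate [l] maps the pair [(x_l f_l, d * geomsum f l)] to
    [(cayley f l, d * geomsum f l.+1)] by the rotation of cosine [r] and sine [d], which preserves
    the sum of squares. *)
Lemma cayley_defect N f :
  l2norm N (cayley f) ^+ 2 + (1 - r ^+ 2) * rnorm (geomsum f N) ^+ 2 =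
  l2norm N f ^+ 2.
Proof.
elim: N => [|N IHN].
  by rewrite !l2norm_sqr !big_ord0 /= rnorm0 expr0n/= mulr0 addr0.
rewrite !l2norm_sqrS -IHN -!addrA; congr (_ + _).
have -> : rnorm (f N) = rnorm (x N * f N) by rewrite rnormM x1 mul1r.
rewrite /= /cayley -mulrA.
move: (x N * f N) (geomsum f N) => [a b] [c d].
by rewrite !rnorm_sqr !expr2 /=; ring.
Qed.

Lemma cayley_contraction N f : l2norm N (cayley f) <= l2norm N f.
Proof.
rewrite l2norm_le ?l2norm_ge0// -(cayley_defect N f) lerDl.
by rewrite mulr_ge0 ?sqr_ge0 ?(ltW defect_gt0).
Qed.

(** For [x] of modulus 1, the squared moduli of [x - r z] and [r x - z] differ by
    [(1 - r ^ 2) (1 - |z| ^ 2)]. *)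
Lemma stepratio_sqr z l : pole z l != 0 ->
  rnorm (stepratio z l) ^+ 2 =
  1 + (1 - r ^+ 2) * (1 - rnorm z ^+ 2) / rnorm (pole z l) ^+ 2.
Proof.
move=> p0.
have q0 : rnorm (pole z l) ^+ 2 != 0.
  by rewrite expf_neq0//; apply: contra_neq p0 => /rnorm_eq0.
rewrite /stepratio rnormM rnormV exprMn exprVn.
apply: (mulIf q0); rewrite mulfVK// mulrDl divfK// mul1r.
rewrite /pole; have : rnorm (x l) ^+ 2 = 1 by rewrite x1 expr1n.
move: (x l) z {p0 q0} => [a b] [c d].
by rewrite !rnorm_sqr /= => ab; rewrite -[X in X - (c ^+ 2 + _)]ab; ring.
Qed.

(** Outside the unit disc the correction term is negative; the maximum with 0 lets one bound serve
    every [z]. Then use [sqrt (1 + a) <= 1 + a <= exp a]. *)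
Lemma stepratio_le_exp z l : pole z l != 0 ->
  rnorm (stepratio z l) <= expR ((1 - r ^+ 2) * Num.max 0 (1 - rnorm z ^+ 2) /
                            rnorm (pole z l) ^+ 2).
Proof.
move=> p0; set a := _ / _.
have a0 : 0 <= a.
  by rewrite /a !mulr_ge0 ?invr_ge0 ?sqr_ge0 ?le_max ?lexx ?(ltW defect_gt0).
rewrite (le_trans _ (expR_ge1Dx _))//.
rewrite -(ler_pXn2r (n := 2))// ?nnegrE ?rnorm_ge0 ?addr_ge0//.
rewrite stepratio_sqr// (@le_trans _ _ (1 + a))//; last by nra.
rewrite lerD2l ler_wpM2r ?invr_ge0 ?sqr_ge0// ler_wpM2l ?le_max ?lexx ?orbT//.
exact: ltW defect_gt0.
Qed.

(** Unrolling the recursion of [restail], each step multiplies by at most the exponential bound of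
    [stepratio_le_exp]. The factor [N] is a product of two square roots: one from Cauchy-Schwarz on
    the entries of [g], one from passing from a uniform bound to the Euclidean norm. It is harmless
    when [N (1 - r ^ 2)] stays bounded. *)
Lemma resolvent_le z N d g : 0 < d -> (forall l, pole z l != 0) ->
  (forall l, (l < N)%N -> d <= rnorm (pole z l)) ->
  l2norm N (resolvent z g) <=
  d^-1 * (1 + N%:R * (1 - r ^+ 2) * d^-1 *
    expR (\sum_(l < N) (1 - r ^+ 2) * Num.max 0 (1 - rnorm z ^+ 2) /
                            rnorm (pole z l) ^+ 2)) * l2norm N g.
Proof.
move=> d0 p0 dp; pose a l := (1 - r ^+ 2) * Num.max 0 (1 - rnorm z ^+ 2) /
                            rnorm (pole z l) ^+ 2.
have r2 := defect_gt0.
have a0 l : 0 <= a l.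
  by rewrite /a !mulr_ge0 ?invr_ge0 ?sqr_ge0 ?le_max ?lexx ?(ltW r2).
have S0 m : 0 <= \sum_(j < m) rnorm (g j).
  by rewrite sumr_ge0// => i _; exact: rnorm_ge0.
have A0 m : 0 <= \sum_(j < m) a j by rewrite sumr_ge0.
have dp' l : (l < N)%N -> (rnorm (pole z l))^-1 <= d^-1.
  by move=> lN; rewrite lef_pV2 ?posrE ?(lt_le_trans d0) ?dp.
have tail l : (l <= N)%N -> rnorm (restail z g l) <=
    expR (\sum_(m < l) a m) * ((1 - r ^+ 2) * d^-1 * \sum_(j < l) rnorm (g j)).
  elim: l => [_|l IHl lN] /=; first by rewrite rnorm0 !big_ord0 !mulr0.
  have rC1 : rnorm (1 - rC ^+ 2) = 1 - r ^+ 2.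
    by rewrite -rmorphXn -(rmorph1 (real_complex R)) -rmorphB rnorm_real gtr0_norm.
  have term : rnorm ((1 - rC ^+ 2) * x l / pole z l * g l) =
      (1 - r ^+ 2) * (rnorm (pole z l))^-1 * rnorm (g l).
    by rewrite !rnormM x1 mulr1 rnormV rC1.
  rewrite (le_trans (rnormD _ _))// term (rnormM (stepratio z l)).
  rewrite !big_ord_recr/= expRD.
  have := IHl (ltnW lN).
  have := stepratio_le_exp (p0 l); rewrite -/(a l) => Ql.
  move=> /(ler_pM (rnorm_ge0 _) (rnorm_ge0 _) Ql) => h.
  rewrite mulrDr mulrDr lerD//; first by rewrite (le_trans h)// mulrA [_ * expR (a l)]mulrC.
  rewrite -[leLHS]mul1r ler_pM ?mulr_ge0 ?rnorm_ge0 ?(ltW r2) ?invr_ge0 ?rnorm_ge0//.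
    by rewrite -expRD -[leLHS]expR0 ler_expR addr_ge0 ?A0 ?a0.
  by rewrite ler_wpM2r ?rnorm_ge0// ler_wpM2l ?(ltW r2)// dp'.
have -> : d^-1 * (1 + N%:R * (1 - r ^+ 2) * d^-1 * expR (\sum_(l < N) a l)) * l2norm N g =
    d^-1 * (N%:R * (1 - r ^+ 2) * d^-1 * expR (\sum_(l < N) a l) * l2norm N g + l2norm N g).
  by ring.
have resd : l2norm N (resolvent z g) <= d^-1 * l2norm N (restail z g + g).
  have -> : d^-1 = rnorm ((d^-1)%:C%C : CC R) by rewrite rnorm_real gtr0_norm ?invr_gt0.
  rewrite -l2normZ; apply: l2norm_mono => l lN.
  rewrite /resolvent rnormM rnormV [(_ *: _) l]/(_ * _) rnormM mulrC.
  rewrite ler_wpM2r ?rnorm_ge0// rnorm_real gtr0_norm ?invr_gt0//.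
  exact: dp'.
rewrite (le_trans resd)// ler_wpM2l ?invr_ge0 ?(ltW d0)//.
rewrite (le_trans (l2normD _ _ _))// lerD2r.
pose K := expR (\sum_(l < N) a l) * ((1 - r ^+ 2) * d^-1 * (Num.sqrt N%:R * l2norm N g)).
have K0 : 0 <= K.
  by rewrite !mulr_ge0 ?expR_ge0 ?(ltW r2) ?invr_ge0 ?(ltW d0) ?sqrtr_ge0.
rewrite (le_trans (l2norm_sup K0 _))//.
  move=> l lN; rewrite (le_trans (tail l (ltnW lN)))// ler_pM ?expR_ge0//.
  - by rewrite !mulr_ge0 ?(ltW r2) ?invr_ge0 ?(ltW d0).
  - rewrite ler_expR -(big_mkord xpredT a) -[leRHS](big_mkord xpredT a).
    by rewrite [leRHS](big_cat_nat (n := l))//= ?(ltnW lN)// lerDl sumr_ge0.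
  rewrite ler_wpM2l ?mulr_ge0 ?(ltW r2) ?invr_ge0 ?(ltW d0)//.
  rewrite (le_trans _ (sum_l2norm N g))//.
  rewrite -(big_mkord xpredT (fun j => rnorm (g j))).
  rewrite -[leRHS](big_mkord xpredT (fun j => rnorm (g j))).
  rewrite [leRHS](big_cat_nat (n := l))//= ?(ltnW lN)// lerDl sumr_ge0// => i _.
  exact: rnorm_ge0.
rewrite le_eqVlt; apply/orP; left; apply/eqP.
by rewrite /K -[N%:R in RHS](sqr_sqrtr (ler0n R N)); ring.
Qed.

End CayleyProduct.

(** * Roots of unity and a discrete Cauchy estimate *)

(** [X ^ n - 1] splits and is separable in characteristic 0, so it has [n] distinct roots; a set of
    [n] distinct [n]-th roots of unity contains a primitive one. *)
Lemma prim_root_complex (R : realType) (n : nat) : (0 < n)%N ->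
  exists w : CC R, n.-primitive_root w.
Proof.
move=> n0; pose p : {poly CC R} := 'X^n - 1.
have [rs def_p] := closed_field_poly_normal (p : {poly R[i]}).
have monp : p \is monic by rewrite monicXnsubC.
have rsn1 : all n.-unity_root rs.
  apply/allP => w; rewrite -root_prod_XsubC; move: def_p.
  by rewrite (monicP monp) scale1r => <-.
have : has n.-primitive_root rs.
  apply: has_prim_root => //.
    rewrite -separable_prod_XsubC; move: def_p.
    rewrite (monicP monp) scale1r => <-.
    by rewrite separable_Xn_sub_1// pnatr_eq0 -lt0n.
  move/(congr1 (fun q : {poly CC R} => size q)): def_p.
  by rewrite (monicP monp) scale1r size_prod_XsubC size_XnsubC// => -[->].
by move=> /hasP[w _ wn]; exists w.
Qed.

Lemma prim_root_neq0 (F : fieldType) (n : nat) (w : F) :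
  (0 < n)%N -> n.-primitive_root w -> w != 0.
Proof.
move=> n0 /prim_expr_order; apply: contra_eq_neq => ->.
by rewrite expr0n gtn_eqF// eq_sym oner_neq0.
Qed.

Lemma sum_prim_root (R : realType) (M j n : nat) (w : CC R) :
  (0 < M)%N -> M.-primitive_root w -> (j < M)%N -> (n < M)%N ->
  \sum_(i < M) (w ^+ i ^+ n)^-1 * w ^+ i ^+ j = (M * (j == n))%:R.
Proof.
move=> M0 wM jM nM; pose a := w ^+ j / w ^+ n.
have w0 : w != 0 by exact: prim_root_neq0 M0 wM.
transitivity (\sum_(i < M) a ^+ i).
  apply: eq_bigr => i _; rewrite /a exprMn exprVn -!exprM mulrC.
  by rewrite (mulnC j) (mulnC n).
have [jn|jn] := eqVneq j n.
  rewrite muln1 (eq_bigr (fun=> 1)) ?sumr_const ?card_ord// => i _.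
  by rewrite /a jn divff ?expf_neq0// expr1n.
have a1 : a - 1 != 0.
  apply: contra_neq jn => /eqP; rewrite subr_eq0 => /eqP a1.
  have /eqP : w ^+ j = w ^+ n by rewrite -[RHS]mul1r -a1 /a divfK// expf_neq0.
  by rewrite (eq_prim_root_expr wM) !modn_small// => /eqP.
apply: (mulfI a1); rewrite -subrX1 muln0 mulr0.
rewrite /a exprMn exprVn -!exprM !(mulnC _ M) !exprM (prim_expr_order wM).
by rewrite !expr1n invr1 mulr1 subrr.
Qed.

Section InversePowers.
Variables (R : realType) (r : R) (x : nat -> CC R).
Hypothesis x1 : forall m, rnorm (x m) = 1.
Hypothesis r01 : 0 < r < 1.
Local Notation T := (cayley r x).
Local Notation res := (resolvent r x).
Local Notation A := (resolvent r x 0).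
Implicit Types g : nat -> CC R.

Lemma rnorm_pole0 l : rnorm (pole r x 0 l) = r.
Proof.
rewrite /pole subr0 rnormM x1 mulr1 rnorm_real gtr0_norm//.
by case/andP: r01.
Qed.

Lemma pole_neq0 z l : rnorm z != r -> pole r x z l != 0.
Proof.
apply: contra_neq => /eqP; rewrite /pole subr_eq0 => /eqP <-.
by rewrite -[RHS](rnorm_pole0 l) /pole subr0.
Qed.

Lemma pole0_neq0 l : pole r x 0 l != 0.
Proof. by apply: pole_neq0; rewrite rnorm0 eq_sym gt_eqF//; case/andP: r01. Qed.

Lemma cayley0 : T 0 = 0.
Proof.
have := cayley_linear r x 1 0 0; rewrite !scale1r addr0.
by move=> /(congr1 (fun f => f - T 0)); rewrite subrr addrK.
Qed.

Lemma cayley_inverse g : T (A g) = g.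
Proof. by rewrite -[RHS](resolventK g pole0_neq0) scale0r subr0. Qed.

(** The power series of [(T - z)^-1] at 0 in exact truncated form: the remainder is moved into the
    argument, so no infinite series has to be summed. *)
Lemma resolvent_partial z M g : rnorm z != r ->
  res z (g - z ^+ M *: iter M A g) = \sum_(j < M) z ^+ j *: iter j.+1 A g.
Proof.
move=> zr; set u := \sum_(_ < _) _.
suff -> : g - z ^+ M *: iter M A g = T u - z *: u.
  by rewrite cayleyK// => l; exact: pole_neq0.
rewrite {}/u; elim: M => [|M IHM].
  by rewrite big_ord0 scaler0 subr0 expr0 scale1r subrr cayley0.
rewrite big_ord_recr/=; set S := \sum_(_ < _) _ in IHM *.
rewrite (addrC S) cayley_linear (scalerDr z) opprD addrACA -IHM cayley_inverse.
by rewrite scalerA -exprS [RHS]addrC subrKA.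
Qed.

(** At a fixed level [A] is triangular with diagonal entries of modulus [1 / r], so its powers are
    [O(s ^ -M)] when [s < r]. The proof goes coordinate by coordinate. The constant depends on [N]
    and [g]; it only serves to make the truncation remainder vanish. *)
Lemma iter_inverse_bounded (s : R) N g : 0 < s < r ->
  exists C, forall l M, (l < N)%N -> rnorm (iter M A g l) * s ^+ M <= C.
Proof.
move=> /andP[s0 sr]; have r0 : 0 < r by case/andP: r01.
pose b (u : nat -> CC R) := exists C, forall M, rnorm (u M) * s ^+ M <= C.
have bD u v : b u -> b v -> b (fun M => u M + v M).
  move=> [C uC] [D vD]; exists (C + D) => M.
  rewrite (le_trans _ (lerD (uC M) (vD M)))// -mulrDl ler_wpM2r ?exprn_ge0 ?(ltW s0)//.
  exact: rnormD.
have bZ a u : b u -> b (fun M => a * u M).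
  move=> [C uC]; exists (rnorm a * C) => M.
  by rewrite rnormM -mulrA ler_wpM2l ?rnorm_ge0.
have b0 : b (fun=> 0) by exists 0 => M; rewrite rnorm0 mul0r.
have step l : b (fun M => restail r x 0 (iter M A g) l) -> b (fun M => iter M A g l).
  move=> [C tC]; pose t := s / r.
  have t1 : 0 < 1 - t by rewrite subr_gt0 /t ltr_pdivrMr// mul1r.
  have t0 : 0 < t by rewrite divr_gt0.
  have C0 : 0 <= C by rewrite (le_trans _ (tC 0%N))// mulr_ge0 ?rnorm_ge0 ?exprn_ge0 ?(ltW s0).
  (* Chosen so that [t (C + D) <= D], which makes the bound stable under one application of [A], and
     so that it covers the initial value [g l]. *)
  pose D := rnorm (g l) + t * C / (1 - t).
  exists D; elim=> [|M IHM].
    rewrite expr0 mulr1 /= /D lerDl.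
    exact: divr_ge0 (mulr_ge0 (ltW t0) C0) (ltW t1).
  rewrite /= {1}/resolvent rnormM rnormV rnorm_pole0 exprS.
  set P := restail _ _ _ _ _; set Q := iter _ _ _ _.
  have : rnorm (P + Q) * s ^+ M <= C + D.
    rewrite (le_trans _ (lerD (tC M) IHM))// -mulrDl.
    by rewrite ler_wpM2r ?exprn_ge0 ?(ltW s0)// rnormD.
  move=> /(ler_wpM2l (ltW t0)); rewrite /t => h.
  have -> : rnorm (P + Q) / r * (s * s ^+ M) = s / r * (rnorm (P + Q) * s ^+ M) by ring.
  rewrite (le_trans h)// -/t -subr_ge0.
  have -> : D - t * (C + D) = (1 - t) * rnorm (g l).
    by rewrite /D; field; rewrite gt_eqF.
  by rewrite mulr_ge0 ?rnorm_ge0 ?(ltW t1).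
have main l : b (fun M => restail r x 0 (iter M A g) l).
  elim: l => [|l IHl]; first exact: b0.
  have [C lC] := bD _ _ (bZ (stepratio r x 0 l) _ IHl)
    (bZ ((1 - (r%:C%C : CC R) ^+ 2) * x l / pole r x 0 l) _ (step l IHl)).
  by exists C => M; exact: lC.
elim: N => [|N [C IHN]]; first by exists 0.
have [D ND] := step N (main N).
exists (Num.max C D) => l M; rewrite ltnS leq_eqVlt => /predU1P[->|lN].
  by rewrite le_max ND orbT.
by rewrite le_max IHN.
Qed.

Lemma iter_inverse_vanish (s : R) N g n e : 0 < s < r -> 0 < e ->
  exists2 M, (n < M)%N & s ^+ M * l2norm N (iter M A g) <= e.
Proof.
move=> /andP[s0 sr] e0; pose s' := (s + r) / 2.
have s's : s < s' by rewrite /s' ltr_pdivlMr//; lra.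
have s'r : s' < r by rewrite /s' ltr_pdivrMr//; lra.
have s'0 : 0 < s' by exact: lt_trans s's.
have [|C Cb] := @iter_inverse_bounded s' N g; first by rewrite s'0.
pose D := Num.max 0 C.
have D0 : 0 <= D by rewrite le_max lexx.
pose t := s / s'.
have t0 : 0 < t by rewrite divr_gt0.
have t1 : t < 1 by rewrite ltr_pdivrMr// mul1r.
pose K := Num.sqrt N%:R * D + 1.
have K0 : 0 < K by rewrite ltr_wpDl// mulr_ge0 ?sqrtr_ge0.
have : \forall M \near \oo, t ^+ M < e / K.
  have /cvgrPdist_lt /(_ (e / K)) : (fun M => t ^+ M) @ \oo --> (0 : R).
    by apply: cvg_expr; rewrite gtr0_norm.
  rewrite divr_gt0// => /(_ isT); apply: filterS => M /=.
  by rewrite sub0r normrN gtr0_norm ?exprn_gt0.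
move=> [M0 _ M0P]; pose M := maxn M0 n.+1.
exists M; first by rewrite leq_max leqnn orbT.
have sM : 0 < s' ^+ M by rewrite exprn_gt0.
have h : l2norm N (iter M A g) <= Num.sqrt N%:R * (D / s' ^+ M).
  apply: l2norm_sup => [|l lN]; first by rewrite divr_ge0// ltW.
  by rewrite ler_pdivlMr// le_max Cb ?orbT.
rewrite (le_trans (ler_wpM2l _ h)) ?exprn_ge0 ?(ltW s0)//.
have -> : s ^+ M * (Num.sqrt N%:R * (D / s' ^+ M)) = t ^+ M * (Num.sqrt N%:R * D).
  rewrite /t (expr_div_n s s'); move: (s ^+ M) (s' ^+ M)^-1 => a b; ring.
have /ltW/(ler_wpM2r (ltW K0)) := M0P M (leq_maxl _ _).
rewrite /= divfK ?gt_eqF// => /(le_trans _); apply.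
by rewrite ler_wpM2l ?exprn_ge0 ?(ltW t0)// lerDl.
Qed.

(* Cauchy's estimate: [A ^ n.+1] is the coefficient of [z ^ n] in the
   resolvent, extracted by averaging over roots of unity. *)
Lemma inverse_power_le (s K : R) N n g : 0 < s < r ->
  (forall z h, rnorm z = s -> l2norm N (res z h) <= K * l2norm N h) ->
  s ^+ n * l2norm N (iter n.+1 A g) <= K * l2norm N g.
Proof.
move=> s0r resK; have /andP[s0 sr] := s0r.
have K0 : 0 <= `|K| by [].
apply/ler_addgt0Pl => e e0.
have K1 : 0 < `|K| + 1 by rewrite ltr_wpDl.
(* [M] exceeds [n], so that averaging over the [M]-th roots of unity isolates the coefficient of
   index [n], and is large enough for the remainder to be negligible. *)
have [M nM Me] := iter_inverse_vanish N g n s0r (divr_gt0 e0 K1).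
have M0 : (0 < M)%N by exact: leq_ltn_trans nM.
have [w wM] := prim_root_complex R M0.
have w1 : rnorm w = 1.
  apply/eqP; rewrite -(@eqrXn2 _ M)// ?rnorm_ge0//.
  by rewrite -rnormX (prim_expr_order wM) rnorm1 expr1n.
have w0 : w != 0 by exact: prim_root_neq0 M0 wM.
(* All sample points have the same [M]-th power [s ^ M], so a single corrected argument serves for
   all of them. *)
pose h := g - (s%:C%C : CC R) ^+ M *: iter M A g.
pose z i : CC R := s%:C%C * w ^+ i.
have zs i : rnorm (z i) = s.
  by rewrite /z rnormM rnormX w1 expr1n mulr1 rnorm_real gtr0_norm.
have zM i : z i ^+ M = (s%:C%C : CC R) ^+ M.
  by rewrite /z exprMn -exprM mulnC exprM (prim_expr_order wM) expr1n mulr1.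
have avg : (M%:R * (s%:C%C : CC R) ^+ n) *: iter n.+1 A g =
    \sum_(i < M) (w ^+ i ^+ n)^-1 *: res (z i) h.
  transitivity (\sum_(i < M) \sum_(j < M)
      ((w ^+ i ^+ n)^-1 * w ^+ i ^+ j * (s%:C%C : CC R) ^+ j) *: iter j.+1 A g).
    rewrite exchange_big/= (bigD1 (Ordinal nM))//= [X in _ + X]big1 ?addr0.
      rewrite -scaler_suml -mulr_suml sum_prim_root// eqxx muln1 //.
    move=> j jn; rewrite -scaler_suml -mulr_suml sum_prim_root//.
    by rewrite (_ : (j == n :> nat) = false) ?muln0 ?mul0r ?scale0r//; exact/negbTE.
  apply: eq_bigr => i _.
  rewrite /h -(zM i) resolvent_partial; last by rewrite zs lt_eqF.
  rewrite scaler_sumr; apply: eq_bigr => j _.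
  by rewrite scalerA /z exprMn mulrCA mulrC.
have l2sum (I : finType) (F : I -> nat -> CC R) :
    l2norm N (\sum_i F i) <= \sum_i l2norm N (F i).
  elim/big_ind2: _ => [|u a v c ua vc|//].
    by rewrite /l2norm big1 ?sqrtr0// => l _; rewrite rnorm0 expr0n.
  by rewrite (le_trans (l2normD _ _ _))// lerD.
have Mr : 0 < (M%:R : R) by rewrite ltr0n.
rewrite -(ler_pM2l Mr).
have -> : M%:R * (s ^+ n * l2norm N (iter n.+1 A g)) =
    l2norm N ((M%:R * (s%:C%C : CC R) ^+ n) *: iter n.+1 A g).
  rewrite l2normZ rnormM rnormX rnorm_real gtr0_norm// mulrA; congr (_ * _ * _).
  by rewrite -(rmorph_nat (real_complex R)) rnorm_real ger0_norm.
rewrite avg (le_trans (l2sum _ _))//.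
rewrite (le_trans (ler_sum (G := fun=> K * l2norm N h) _ _))//.
  move=> i _; rewrite l2normZ rnormV !rnormX w1 !expr1n invr1 mul1r resK//.
rewrite sumr_const card_ord -[leLHS]mulr_natl ler_pM2l//.
have hl : l2norm N h <= l2norm N g + e / (`|K| + 1).
  rewrite /h -scaleN1r scalerA (le_trans (l2normD _ _ _))// lerD2l l2normZ.
  rewrite rnormM rnormN rnorm1 mul1r rnormX rnorm_real gtr0_norm//.
have Kh : `|K| * (e / (`|K| + 1)) <= e.
  by rewrite mulrCA ger_pMr// ler_pdivrMr// mul1r lerDl.
have lh0 := l2norm_ge0 N h; have lg0 := l2norm_ge0 N g.
have [K0'|K0'] := leP 0 K.
  move: Kh; rewrite ger0_norm// => Kh.
  have := ler_wpM2l K0' hl; rewrite (ger0_norm K0') mulrDr; lra.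
(* Here [K] is negative, and the resolvent bound at [z = s] then forces [g] to vanish on the
   level. *)
have N0 : l2norm N g = 0.
  have := resK (s%:C%C) g; rewrite rnorm_real gtr0_norm// => /(_ erefl).
  have := l2norm_ge0 N (res s%:C%C g); nra.
have : K * l2norm N h <= 0 by rewrite nmulr_rle0.
rewrite N0; lra.
Qed.

End InversePowers.

(** * Estimates uniform in the level *)

Lemma expR_half_sqr (R : realType) (y : R) : 0 <= y -> y ^+ 2 <= 4 * expR y.
Proof.
move=> y0; have h : y / 2 <= expR (y / 2).
  by have := expR_ge1Dx (y / 2); lra.
have : (y / 2) ^+ 2 <= expR (y / 2) ^+ 2.
  by rewrite ler_pXn2r// nnegrE ?expR_ge0// divr_ge0.
by rewrite -expRM_natl (_ : 2%:R * (y / 2) = y); [lra|field].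
Qed.

Lemma expRN2_le (R : realType) (u : R) : 0 <= u -> u <= 2^-1 -> expR (- (2 * u)) <= 1 - u.
Proof.
move=> u0 u2.
have h : 1 + 2 * u <= expR (2 * u) by exact: expR_ge1Dx.
rewrite expRN -[1 - u]invrK lef_pV2 ?posrE ?expR_gt0//; last by rewrite invr_gt0; lra.
rewrite (le_trans _ h)// -[leLHS]mul1r ler_pdivrMr; last by lra.
nra.
Qed.

Section Estimates.
Variables (R : realType) (x : nat -> CC R).
Hypothesis x1 : forall m, rnorm (x m) = 1.

(** A power of 2, so that the classes modulo [2 ^ i] share the indices equally, and at least 2, so
    that [damping] is positive. *)
Definition level k : nat := (2 ^ k.+1)%N.
(** This choice keeps [N (1 - r ^ 2)] between 1 and 2; the upper and lower resolvent bounds both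
    rest on it. *)
Definition damping k : R := 1 - (level k)%:R^-1.

Lemma level_gt0 k : 0 < ((level k)%:R : R).
Proof. by rewrite ltr0n expn_gt0. Qed.

Lemma level_inv_le e : 0 < e -> \forall k \near \oo, ((level k)%:R^-1 : R) <= e.
Proof.
move=> e0; have [k0 _ k0P] := near_infty_natSinv_expn_lt (PosNum e0).
exists k0 => // k /= /k0P /= h; rewrite (le_trans _ (ltW h))//.
rewrite div1r /level natrX lef_pV2 ?posrE ?exprn_gt0//.
by rewrite ler_eXn2l// ltr1n.
Qed.

Lemma damping01 k : 0 < damping k < 1.
Proof.
rewrite /damping subr_gt0 ltrBlDr ltrDl invr_gt0 level_gt0 andbT.
rewrite invf_lt1 ?level_gt0// /level natrX exprS.
have : 1 <= 2 ^+ k :> R by rewrite exprn_ege1// ler1n.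
lra.
Qed.

Lemma level_defect k : (level k)%:R * (1 - damping k ^+ 2) <= 2 :> R.
Proof.
have N0 := level_gt0 k; have := damping01 k; rewrite /damping.
set u := _^-1 => /andP[u1 u0].
have Nu : (level k)%:R * u = 1 by rewrite divff ?gt_eqF.
have -> : (level k)%:R * (1 - (1 - u) ^+ 2) = (level k)%:R * u * (2 - u) by ring.
rewrite Nu; lra.
Qed.

Lemma level_defect_ge k : 1 <= (level k)%:R * (1 - damping k ^+ 2).
Proof.
have N0 := level_gt0 k; have := damping01 k; rewrite /damping.
set u := _^-1 => /andP[u1 u0].
have Nu : (level k)%:R * u = 1 by rewrite divff ?gt_eqF.
have -> : (level k)%:R * (1 - (1 - u) ^+ 2) = (level k)%:R * u * (2 - u) by ring.
rewrite Nu; lra.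
Qed.

Lemma pole_dist k z l :
  rnorm (x l - z) - (level k)%:R^-1 <= rnorm (pole (damping k) x z l).
Proof.
rewrite lerBlDr.
have -> : x l - z = pole (damping k) x z l + ((level k)%:R^-1)%:C%C * x l.
  by rewrite /pole /damping rmorphB rmorph1; ring.
rewrite (le_trans (rnormD _ _))// lerD2l rnormM x1 mulr1 rnorm_real.
by rewrite gtr0_norm// invr_gt0 level_gt0.
Qed.

(** Away from the points of [x], the exponent in [resolvent_le] has [N] terms of size
    [O(1 - r ^ 2) = O(1 / N)]. The poles differ from [x l - z] by [1 / N], which costs half of [d]
    for large [k]. *)
Lemma resolvent_bounded z d : 0 < d -> (forall l, d <= rnorm (x l - z)) ->
  exists c, 0 <= c /\ \forall k \near \oo,
    (forall l, pole (damping k) x z l != 0) /\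
    forall g, l2norm (level k) (resolvent (damping k) x z g) <=
              c * l2norm (level k) g.
Proof.
move=> d0 dx; have d2 : 0 < d / 2 by rewrite divr_gt0.
exists ((d / 2)^-1 * (1 + 2 * (d / 2)^-1 * expR (2 / (d / 2) ^+ 2))); split.
  by rewrite mulr_ge0 ?addr_ge0 ?mulr_ge0 ?expR_ge0 ?invr_ge0 ?(ltW d2).
near=> k.
have poled l : d / 2 <= rnorm (pole (damping k) x z l).
  rewrite (le_trans _ (pole_dist k z l))//.
  have : (level k)%:R^-1 <= d / 2 by near: k; exact: level_inv_le.
  have := dx l; lra.
have pole0 l : pole (damping k) x z l != 0.
  by apply/eqP => p0; have := poled l; rewrite p0 rnorm0; lra.
split=> // g; have r01 := damping01 k.
rewrite (le_trans (resolvent_le x1 r01 g d2 pole0 (fun l _ => poled l)))//.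
have r2 := defect_gt0 r01.
rewrite ler_wpM2r ?l2norm_ge0// ler_wpM2l ?invr_ge0 ?(ltW d2)// lerD2l.
rewrite ler_pM ?expR_ge0 ?mulr_ge0 ?invr_ge0 ?(ltW d2) ?(ltW r2)//.
  by rewrite ler_wpM2r ?invr_ge0 ?(ltW d2)// level_defect.
rewrite ler_expR.
pose c := (1 - damping k ^+ 2) / (d / 2) ^+ 2.
rewrite (le_trans (ler_sum (G := fun=> c) _ _))//.
  move=> l _; rewrite /c ler_pM ?invr_ge0 ?sqr_ge0 ?mulr_ge0 ?le_max ?lexx ?(ltW r2)//.
    by rewrite -[leRHS]mulr1 ler_wpM2l ?(ltW r2)// ge_max ler01/= gerBl sqr_ge0.
  rewrite lef_pV2 ?posrE ?exprn_gt0 ?(lt_le_trans d2)//.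
  by rewrite ler_pXn2r ?nnegrE ?rnorm_ge0 ?(ltW d2).
rewrite sumr_const card_ord -[leLHS]mulr_natl /c mulrA.
by rewrite ler_wpM2r ?invr_ge0 ?sqr_ge0// level_defect.
Unshelve. all: by end_near. Qed.

(** Points within [D] of [z] are within [2 D] of each other, so their indices agree modulo [2 ^ i]
    and are told apart by their quotients by [2 ^ i]. *)
Lemma card_cluster i K (D : R) z : (i <= K)%N ->
  (forall m m', rnorm (x m - x m') < 2 * D -> m = m' %[mod 2 ^ i]) ->
  (#|[pred l : 'I_(2 ^ K) | (rnorm (x l - z) < D)%R]| <= 2 ^ (K - i))%N.
Proof.
move=> iK sep.
have fP (l : 'I_(2 ^ K)) : (l %/ 2 ^ i < 2 ^ (K - i))%N.
  by rewrite ltn_divLR ?expn_gt0// -expnD subnK.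
pose f l := Ordinal (fP l).
rewrite -[leqRHS]card_ord.
apply: (@leq_card_in _ _ f) => l l'; rewrite !inE => lz l'z [ll'].
apply: val_inj; rewrite /= (divn_eq l (2 ^ i)) (divn_eq l' (2 ^ i)) ll'.
congr addn; apply: sep.
have := rnormD (x l - z) (z - x l'); rewrite subrKA => /le_lt_trans; apply.
by rewrite (rdistC z); lra.
Qed.

(** The bound of [resolvent_le] with poles at least [s / 2]. In the exponent, [16 / 2 ^+ i / s]
    comes from the points within [D] of [z] and [8 / D ^+ 2] from the others. *)
Definition growth_const (i : nat) (D s : R) : R :=
  (s / 2)^-1 * (1 + 2 * (s / 2)^-1 * expR (16 / 2 ^+ i / s + 8 / D ^+ 2)).

(* [s] is [1 - `|z|].  Only the points of a single class mod [2 ^ i], i.e. a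
   proportion [2 ^- i] of them, lie within [D] of [z]; each contributes at most
   [O(s / s ^ 2)] to the Poisson-like sum in the exponent of [resolvent_le]. *)
Lemma resolvent_growth i (D s : R) : 0 < D ->
  (forall m m', rnorm (x m - x m') < 2 * D -> m = m' %[mod 2 ^ i]) ->
  0 < s < 1 -> \forall k \near \oo, 1 - s < damping k /\
    forall z g, rnorm z = 1 - s ->
      l2norm (level k) (resolvent (damping k) x z g) <=
      growth_const i D s * l2norm (level k) g.
Proof.
move=> D0 sep /andP[s0 s1]; near=> k.
have N0 := level_gt0 k; have r01 := damping01 k; have r2 := defect_gt0 r01.
have Ns : (level k)%:R^-1 <= s / 2 by near: k; apply: level_inv_le; rewrite divr_gt0.
have ND : (level k)%:R^-1 <= D / 2 by near: k; apply: level_inv_le; rewrite divr_gt0.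
have ik : (i <= k.+1)%N.
  by apply/leqW; near: k; exact: nbhs_infty_ge.
have s20 : 0 < s / 2 by rewrite divr_gt0.
split; first by rewrite /damping; lra.
move=> z g zs.
have pole_s l : s / 2 <= rnorm (pole (damping k) x z l).
  rewrite (le_trans _ (pole_dist k z l))//.
  by have := rnorm_distB (x l) z; rewrite x1 zs; lra.
have pole_D l : D <= rnorm (x l - z) -> D / 2 <= rnorm (pole (damping k) x z l).
  by move=> Dl; rewrite (le_trans _ (pole_dist k z l))//; lra.
have pole0 l : pole (damping k) x z l != 0.
  by apply/eqP => p0; have := pole_s l; rewrite p0 rnorm0; lra.
rewrite (le_trans (resolvent_le x1 r01 g s20 pole0 (fun l _ => pole_s l)))//.
rewrite ler_wpM2r ?l2norm_ge0// ler_wpM2l ?invr_ge0 ?(ltW s20)// lerD2l.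
rewrite ler_pM ?expR_ge0 ?mulr_ge0 ?invr_ge0 ?(ltW s20) ?(ltW r2)//.
  by rewrite ler_wpM2r ?invr_ge0 ?(ltW s20)// level_defect.
rewrite ler_expR zs.
have m1 : 0 <= 1 - (1 - s) ^+ 2 by nra.
rewrite (max_idPr m1).
pose c := 1 - damping k ^+ 2.
pose near l := rnorm (x l - z) < D.
(* [u] majorizes the term of a far point and [v] that of a near one, using [1 - |z| ^ 2 <= 2 s]. *)
pose u := c / (D / 2) ^+ 2; pose v := c * (2 * s) / (s / 2) ^+ 2.
have uv0 : 0 <= u /\ 0 <= v.
  by split; rewrite /u /v /c !mulr_ge0 ?invr_ge0 ?sqr_ge0 ?(ltW r2) ?(ltW s0).
rewrite (le_trans (ler_sum (G := fun l : 'I__ => u + (if near l then v else 0)) _ _))//.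
  move=> l _; rewrite /near; case: ltP => [lD|Dl].
    rewrite (@le_trans _ _ v)//; last by rewrite lerDr; case: uv0.
    rewrite /v -mulrA -[leRHS]mulrA ler_wpM2l ?(ltW r2)//.
    rewrite ler_pM ?invr_ge0 ?sqr_ge0//; first by nra.
    rewrite lef_pV2 ?posrE ?exprn_gt0 ?(lt_le_trans s20)//.
    by rewrite ler_pXn2r ?nnegrE ?rnorm_ge0 ?(ltW s20).
  rewrite addr0 /u -mulrA ler_wpM2l ?(ltW r2)//.
  rewrite -[leRHS]mul1r ler_pM ?invr_ge0 ?sqr_ge0//; first by nra.
  have D2 : 0 < D / 2 by rewrite divr_gt0.
  have pD := pole_D l Dl.
  rewrite lef_pV2 ?posrE ?exprn_gt0 ?(lt_le_trans D2)//.
  by rewrite ler_pXn2r ?nnegrE ?rnorm_ge0 ?(ltW D2).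
rewrite big_split/= sumr_const card_ord -big_mkcond/= sumr_const.
have cardn : #|[pred l : 'I_(level k) | near l]|%:R * 2 ^+ i <= (level k)%:R :> R.
  have lv : level k = (2 ^ (k.+1 - i) * 2 ^ i)%N by rewrite -expnD subnK.
  rewrite -natrX -natrM ler_nat [leqRHS]lv leq_mul2r.
  by rewrite (card_cluster z ik sep) orbT.
have Nc : (level k)%:R * c <= 2 by exact: level_defect.
rewrite addrC lerD//; last first.
  rewrite -[leLHS]mulr_natl /u mulrA.
  have -> : 8 / D ^+ 2 = 2 / (D / 2) ^+ 2 by field; rewrite gt_eqF.
  by rewrite ler_wpM2r ?invr_ge0 ?sqr_ge0.
have i0 : 0 < 2 ^+ i :> R by rewrite exprn_gt0.
rewrite -[leLHS]mulr_natl.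
have -> : 16 / 2 ^+ i / s = 2 * (2 * s / (s / 2) ^+ 2) / 2 ^+ i.
  by field; rewrite !gt_eqF.
rewrite ler_pdivlMr// [leLHS]mulrAC.
rewrite (le_trans (ler_wpM2r _ cardn)) ?(proj2 uv0)//.
rewrite /v -(mulrA c) (mulrA _ c) ler_wpM2r//.
by rewrite divr_ge0 ?sqr_ge0// mulr_ge0// ltW.
Unshelve. all: by end_near. Qed.

End Estimates.

(** * Subexponential growth of the inverse powers *)

Section InverseGrowth.
Variables (R : realType) (x : nat -> CC R).
Hypothesis x1 : forall m, rnorm (x m) = 1.
Hypothesis separated : forall i, exists2 d : R, 0 < d &
  forall m m', m != m' %[mod 2 ^ i] -> d <= rnorm (x m - x m').

(** Cauchy's estimate on the circle of radius [1 - s], with [s] of order [1 / sqrt n]: both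
    [(1 - s) ^- n] and the exponent [16 / 2 ^+ i / s] of the resolvent bound are then exponentials
    of a small multiple of [sqrt n]. The constant [C] depends on [eps] only; the level from which
    the bound holds may depend on [n]. *)
Lemma inverse_growth (eps : R) : 0 < eps -> exists C, 0 <= C /\ forall n,
  \forall k \near \oo, forall g,
    l2norm (level k) (iter n.+1 (resolvent (damping R k) x 0) g) <=
    C * expR (eps * Num.sqrt n.+1%:R) * l2norm (level k) g.
Proof.
(* The bound [eps / 8] lets [(1 - s) ^- n] cost at most [eps / 4] in the exponent; the bound [1 / 4]
   keeps [s] in the range of [expRN2_le]. *)
move=> eps0; pose eta : R := Num.min 4^-1 (eps / 8).
have eta0 : 0 < eta by rewrite lt_min invr_gt0 ltr0n divr_gt0.
have eta4 : eta <= 4^-1 by rewrite ge_min lexx.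
have etae : eta <= eps / 8 by rewrite ge_min lexx orbT.
(* With [2 ^- i < eta * eps / 64], the contribution of the near points costs another [eps / 4]. *)
have [i _ /(_ i (leqnn i)) /=] := near_infty_natSinv_expn_lt
  (PosNum (divr_gt0 (mulr_gt0 eta0 eps0) (ltr0n R 64))).
rewrite /= div1r => iP.
have [d d0 dP] := separated i; pose D := d / 2.
have D0 : 0 < D by rewrite divr_gt0.
have sep m m' : rnorm (x m - x m') < 2 * D -> m = m' %[mod 2 ^ i].
  move=> mD; apply/eqP; apply: contraTT mD => /dP.
  by rewrite -leNgt /D mulrC divfK.
pose Y := expR (8 / D ^+ 2); pose C1 := 2 / eta * (1 + 4 / eta) * Y.
have Y1 : 1 <= Y by rewrite -[leLHS]expR0 ler_expR divr_ge0// sqr_ge0.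
have eta1 : 0 < 4 / eta by rewrite divr_gt0.
have C10 : 0 <= C1.
  by rewrite !mulr_ge0 ?addr_ge0 ?expR_ge0 ?invr_ge0 ?(ltW eta0) ?(ltW eta1).
exists (C1 * (16 / eps ^+ 2)); split.
  by rewrite mulr_ge0// divr_ge0// sqr_ge0.
move=> n; pose q : R := Num.sqrt n.+1%:R.
have q1 : 1 <= q by rewrite -sqrtr1 ler_wsqrtr// ler1n.
have q0 : 0 < q by rewrite (lt_le_trans ltr01).
have qq : q ^+ 2 = n.+1%:R by rewrite sqr_sqrtr.
pose s := eta / q.
have s0 : 0 < s by rewrite divr_gt0.
have s4 : s <= 4^-1 by rewrite /s ler_pdivrMr// (le_trans eta4)// ler_peMr.
have s1 : s < 1 by rewrite (le_lt_trans s4)// invf_lt1// ltr1n.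
have s01 : 0 < s < 1 by rewrite s0.
near=> k => g.
have [sr resK] : 1 - s < damping R k /\ forall z g, rnorm z = 1 - s ->
      l2norm (level k) (resolvent (damping R k) x z g) <=
      growth_const i D s * l2norm (level k) g.
  by near: k; exact: resolvent_growth.
have s1r : 0 < 1 - s < damping R k by rewrite sr subr_gt0 s1.
have := @inverse_power_le R (damping R k) x x1 (damping01 R k) (1 - s) _ (level k) n g s1r resK.
set a := l2norm _ _; set b := l2norm _ g => h.
have a0 : 0 <= a by exact: l2norm_ge0.
have b0 : 0 <= b by exact: l2norm_ge0.
have powP : expR (- (eps / 4 * q)) <= (1 - s) ^+ n.
  apply: (@le_trans _ _ (expR (- (2 * s)) ^+ n)).
    rewrite -expRM_natl ler_expR mulrN lerN2.
    have -> : eps / 4 * q = (2 * (eps / 8 / q)) * q ^+ 2.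
      by field; rewrite gt_eqF.
    rewrite qq [leLHS]mulrC.
    have se : 2 * s <= 2 * (eps / 8 / q).
      by rewrite ler_wpM2l// /s ler_wpM2r// invr_ge0 ltW.
    have s20 : 0 <= 2 * s by exact: mulr_ge0 (ltW s0).
    have nn : (n%:R : R) <= n.+1%:R by rewrite ler_nat.
    exact: ler_pM s20 (ler0n _ _) se nn.
  apply: lerXn2r; rewrite ?nnegrE ?expR_ge0 ?subr_ge0 ?(ltW s1)//.
  by rewrite expRN2_le ?(ltW s0)// (le_trans s4)// lef_pV2 ?posrE// ler_nat.
have K_le : growth_const i D s <= C1 * q ^+ 2 * expR (eps / 4 * q).
  have X1 : 1 <= expR (eps / 4 * q).
    by rewrite -[leLHS]expR0 ler_expR mulr_ge0 ?divr_ge0 ?(ltW eps0) ?(ltW q0).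
  have sV : (s / 2)^-1 = 2 / eta * q by rewrite /s; field; rewrite !gt_eqF.
  rewrite /growth_const sV.
  have -> : C1 * q ^+ 2 * expR (eps / 4 * q) =
    2 / eta * q * (q * (expR (eps / 4 * q) * Y) + 4 / eta * q * (expR (eps / 4 * q) * Y)).
    by rewrite /C1; ring.
  rewrite ler_wpM2l ?mulr_ge0 ?invr_ge0 ?(ltW eta0) ?(ltW q0)//.
  rewrite lerD//.
    by rewrite -[leLHS]mulr1 ler_pM// -[leLHS]mulr1 ler_pM.
  have -> : 2 * (2 / eta * q) = 4 / eta * q by ring.
  rewrite ler_wpM2l ?mulr_ge0 ?invr_ge0 ?(ltW eta0) ?(ltW q0)//.
  rewrite expRD ler_wpM2r ?expR_ge0// ler_expR.
  have -> : 16 / 2 ^+ i / s = 16 / eta * 2 ^- i * q.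
    by rewrite /s; field; rewrite !gt_eqF// exprn_gt0.
  rewrite ler_wpM2r ?(ltW q0)//.
  have -> : eps / 4 = 16 / eta * (eta * eps / 64) by field; rewrite gt_eqF.
  by rewrite ler_wpM2l ?divr_ge0 ?(ltW eta0)// ltW.
(* The two factors [2 / s] of [growth_const] give [q ^+ 2], absorbed by the remaining [eps / 2]. *)
have q2 : q ^+ 2 <= 16 / eps ^+ 2 * expR (eps / 2 * q).
  have := @expR_half_sqr R (eps / 2 * q).
  rewrite mulr_ge0 ?divr_ge0 ?(ltW eps0) ?(ltW q0)// => /(_ isT).
  have -> : 16 / eps ^+ 2 * expR (eps / 2 * q) = 4 * expR (eps / 2 * q) * (4 / eps ^+ 2).
    by ring.
  have -> : q ^+ 2 = (eps / 2 * q) ^+ 2 * (4 / eps ^+ 2) by field; rewrite gt_eqF.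
  by move=> ?; rewrite ler_wpM2r// divr_ge0// sqr_ge0.
have E : expR (eps * q) = expR (eps / 4 * q) * expR (eps / 4 * q) * expR (eps / 2 * q).
  by rewrite -!expRD; congr expR; field.
have e0 := expR_gt0 (eps / 4 * q).
have : expR (- (eps / 4 * q)) * a <= growth_const i D s * b.
  exact: le_trans (ler_wpM2r a0 powP) h.
rewrite expRN ler_pdivrMl// => /le_trans; apply.
rewrite [leLHS]mulrA ler_wpM2r// E.
apply: (le_trans (ler_wpM2l (ltW e0) K_le)).
have -> : expR (eps / 4 * q) * (C1 * q ^+ 2 * expR (eps / 4 * q)) =
  q ^+ 2 * (C1 * expR (eps / 4 * q) * expR (eps / 4 * q)) by ring.
apply: le_trans (ler_wpM2r _ q2) _.
  exact: mulr_ge0 (mulr_ge0 C10 (ltW e0)) (ltW e0).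
rewrite le_eqVlt; apply/orP; left; apply/eqP; ring.
Unshelve. all: by end_near. Qed.

End InverseGrowth.

(** * Lower bounds for the resolvent *)

Section LowerBound.
Variables (R : realType) (r : R) (x : nat -> CC R).
Hypothesis x1 : forall m, rnorm (x m) = 1.
Hypothesis r01 : 0 < r < 1.

Lemma stepratio_ge1 z l : rnorm z <= 1 -> pole r x z l != 0 ->
  1 <= rnorm (stepratio r x z l).
Proof.
move=> z1 p0; rewrite -(ler_pXn2r (n := 2))// ?nnegrE ?rnorm_ge0//.
rewrite (stepratio_sqr x1)// expr1n lerDl divr_ge0 ?sqr_ge0//.
by rewrite mulr_ge0 ?(ltW (defect_gt0 r01))// subr_ge0 expr_le1 ?rnorm_ge0.
Qed.

(** Variation of constants for the recursion of [restail]: [P z] solves the homogeneous recursion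
    and [c z j] is the weight of the entry [g j]. *)
Let P z l := \prod_(0 <= m < l) stepratio r x z m.
Let c z j := (1 - (r%:C%C : CC R) ^+ 2) * x j / pole r x z j / P z j.+1.

Lemma restailE z g l : rnorm z <= 1 -> (forall l, pole r x z l != 0) ->
  restail r x z g l = P z l * \sum_(j < l) c z j * g j.
Proof.
move=> z1 p0; have Q0 m : stepratio r x z m != 0.
  apply/eqP => Q0; have := stepratio_ge1 z1 (p0 m); rewrite Q0 rnorm0; lra.
elim: l => [|l IHl] /=; first by rewrite big_ord0 mulr0.
rewrite IHl big_ord_recr/= mulrDr mulrA; congr (_ + _).
  by rewrite /P big_nat_recr//= (mulrC (stepratio _ _ _ _)).
rewrite /c mulrA; congr (_ * _); rewrite [RHS]mulrC divfK//.
by rewrite /P big_mkord; apply/prodf_neq0 => m _; exact: Q0.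
Qed.

Lemma rnormP_ge1 z l : rnorm z <= 1 -> (forall l, pole r x z l != 0) ->
  1 <= rnorm (P z l).
Proof.
move=> z1 p0; rewrite /P rnorm_prod; elim: l => [|l IHl].
  by rewrite big_geq.
by rewrite big_nat_recr//= -[leLHS]mulr1 ler_pM// stepratio_ge1.
Qed.

Lemma rnormP_mono z a b : (a <= b)%N -> rnorm z <= 1 ->
  (forall l, pole r x z l != 0) -> rnorm (P z a) <= rnorm (P z b).
Proof.
move=> ab z1 p0; elim: b ab => [|b IHb]; first by rewrite leqn0 => /eqP ->.
rewrite leq_eqVlt ltnS => /predU1P[->//|/IHb /le_trans]; apply.
by rewrite /P big_nat_recr//= rnormM ler_peMr ?rnorm_ge0// stepratio_ge1.
Qed.

(* The test vector lives on the first quarter of the indices, with phases making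
   all contributions to the last quarter add up; these are multiplied by the
   step ratios of the middle half. *)
Lemma resolvent_ge z q : (0 < q)%N -> rnorm z <= 1 ->
  (forall l, pole r x z l != 0) -> 1 <= (4 * q)%:R * (1 - r ^+ 2) ->
  exists2 g, l2norm (4 * q) g <= 1 &
    \prod_(q <= m < 3 * q) rnorm (stepratio r x z m) <=
    32 * l2norm (4 * q) (resolvent r x z g).
Proof.
move=> q0 z1 p0 Nr.
have qR : 0 < (q%:R : R) by rewrite ltr0n.
pose N : R := (4 * q)%:R; have NE : N = 4 * q%:R by rewrite /N natrM.
have N0 : 0 < N by rewrite NE mulr_gt0.
pose t : R := (Num.sqrt N)^-1.
have t0 : 0 < t by rewrite invr_gt0 sqrtr_gt0.
have t2 : t ^+ 2 = N^-1 by rewrite exprVn sqr_sqrtr// ltW.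
have r2 := defect_gt0 r01.
have pR l : 0 < rnorm (pole r x z l).
  by rewrite lt_def rnorm_ge0 andbT; apply: contra_neq (p0 l) => /rnorm_eq0.
have p2 l : rnorm (pole r x z l) <= 2.
  rewrite (le_trans (rnormB _ _))// rnormM x1 mulr1 rnorm_real.
  by case/andP: r01 => r0 r1; rewrite gtr0_norm//; lra.
have PR l : 0 < rnorm (P z l) by rewrite (lt_le_trans ltr01) ?rnormP_ge1.
have cE j : rnorm (c z j) = (1 - r ^+ 2) / rnorm (pole r x z j) / rnorm (P z j.+1).
  rewrite /c !rnormM x1 mulr1 !rnormV.
  by rewrite -rmorphXn -(rmorph1 (real_complex R)) -rmorphB rnorm_real gtr0_norm.
have cR j : 0 < rnorm (c z j) by rewrite cE !divr_gt0.
have c0 j : c z j != 0.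
  by apply: contraTneq (cR j) => ->; rewrite rnorm0 ltxx.
have cq j : (j < q)%N -> (1 - r ^+ 2) / 2 / rnorm (P z q) <= rnorm (c z j).
  move=> jq; rewrite cE ler_pM ?invr_ge0 ?divr_ge0 ?rnorm_ge0 ?(ltW r2)//.
    by rewrite ler_wpM2l ?(ltW r2)// lef_pV2 ?posrE.
  by rewrite lef_pV2 ?posrE// rnormP_mono.
pose g j : CC R := if (j < q)%N then (t * rnorm (c z j))%:C%C / c z j else 0.
have cg j : (j < q)%N -> c z j * g j = (t * rnorm (c z j))%:C%C.
  by move=> jq; rewrite /g jq mulrC divfK.
have gn j : (j < q)%N -> rnorm (g j) = t.
  move=> jq; rewrite /g jq rnormM rnormV rnorm_real gtr0_norm ?mulr_gt0//.
  by rewrite mulfK// gt_eqF.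
exists g.
  rewrite l2norm_le// l2norm_sqr expr1n.
  rewrite (le_trans (ler_sum (G := fun=> t ^+ 2) _ _))//.
    move=> l _; rewrite ler_pXn2r ?nnegrE ?rnorm_ge0 ?(ltW t0)//.
    have [lq|lq] := ltnP l q; first by rewrite gn.
    by rewrite /g ltnNge lq rnorm0 ltW.
  by rewrite sumr_const card_ord t2 -[leLHS]mulr_natl divff// gt_eqF.
pose S := \sum_(j < q) rnorm (c z j).
have Sq : (1 - r ^+ 2) / 2 / rnorm (P z q) * q%:R <= S.
  have cS : \sum_(j < q) ((1 - r ^+ 2) / 2 / rnorm (P z q)) <= S.
    by apply: ler_sum => j _; exact: cq.
  by rewrite (le_trans _ cS)// sumr_const card_ord mulr_natr.
have tail l : (q <= l)%N -> rnorm (restail r x z g l) = rnorm (P z l) * (t * S).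
  move=> ql; rewrite restailE// rnormM; congr (_ * _).
  have -> : \sum_(j < l) c z j * g j = (t * S)%:C%C.
    rewrite -(big_mkord xpredT (fun j => c z j * g j)) (big_cat_nat (n := q))//=.
    rewrite [X in _ + X]big_nat [X in _ + X]big1 ?addr0; last first.
      by move=> j /andP[qj _]; rewrite /g ltnNge qj mulr0.
    rewrite big_mkord /S mulr_sumr rmorph_sum; apply: eq_bigr => j _.
    exact: cg.
  rewrite rnorm_real ger0_norm// mulr_ge0 ?(ltW t0)// sumr_ge0// => j _.
  exact: rnorm_ge0.
have Pq : \prod_(q <= m < 3 * q) rnorm (stepratio r x z m) =
    rnorm (P z (3 * q)%N) / rnorm (P z q).
  have -> : P z (3 * q)%N = P z q * \prod_(q <= m < 3 * q) stepratio r x z m.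
    by rewrite /P -(big_cat_nat (n := q))//= -[leqLHS]mul1n leq_mul2r orbT.
  by rewrite rnormM mulrAC divff ?gt_eqF// mul1r rnorm_prod.
rewrite Pq; set W := _ / _.
have W0 : 0 <= W by rewrite divr_ge0 ?rnorm_ge0.
(* One factor 8 comes from [N (1 - r ^ 2) >= 1] in the lower bound for [S], and a factor 2 from
   poles of modulus at most 2. *)
have res_ge l : (3 * q <= l)%N -> W * (t / 16) <= rnorm (resolvent r x z g l).
  move=> ql; have ql' : (q <= l)%N by rewrite (leq_trans _ ql)// -[leqLHS]mul1n leq_mul2r orbT.
  rewrite /resolvent {2}/g ltnNge ql' addr0 rnormM rnormV tail//.
  have -> : W * (t / 16) = rnorm (P z (3 * q)%N) * (t * (8^-1 / rnorm (P z q))) / 2.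
    by rewrite /W; field; rewrite (gt_eqF (PR q)).
  rewrite ler_pM ?invr_ge0 ?mulr_ge0 ?rnorm_ge0 ?(ltW t0) ?invr_ge0 ?rnorm_ge0//.
    rewrite ler_pM ?mulr_ge0 ?rnorm_ge0 ?(ltW t0) ?invr_ge0 ?rnorm_ge0//.
      exact: rnormP_mono.
    rewrite ler_wpM2l ?(ltW t0)// (le_trans _ Sq)//.
    have -> : (1 - r ^+ 2) / 2 / rnorm (P z q) * q%:R =
      (N * (1 - r ^+ 2)) / 8 / rnorm (P z q) by rewrite NE; field; rewrite (gt_eqF (PR q)).
    by rewrite ler_wpM2r ?invr_ge0 ?rnorm_ge0// -[leLHS]mul1r ler_wpM2r.
  by rewrite lef_pV2 ?posrE.
rewrite -ler_pdivrMl// -(ler_pXn2r (n := 2))// ?nnegrE ?l2norm_ge0//; last first.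
  by rewrite mulr_ge0.
rewrite l2norm_sqr.
rewrite -(big_mkord xpredT (fun l => rnorm (resolvent r x z g l) ^+ 2)).
rewrite (big_cat_nat (n := 3 * q)%N)//=; last by rewrite leq_mul2r orbT.
apply: ler_wpDl; first by apply: sumr_ge0 => l _; exact: sqr_ge0.
(* The last quarter has [q = N / 4] entries and [t ^+ 2 = 1 / N], so the sum is
   [W ^+ 2 / (4 * 256) = (W / 32) ^+ 2]. *)
apply: (@le_trans _ _ (\sum_(3 * q <= l < 4 * q) (W * (t / 16)) ^+ 2)).
  rewrite sumr_const_nat -mulnBl mul1n -[leRHS]mulr_natl.
  have -> : q%:R * (W * (t / 16)) ^+ 2 = W ^+ 2 * (q%:R * t ^+ 2 / 256) by field.
  rewrite t2 NE exprMn mulrC ler_wpM2l ?sqr_ge0//.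
  rewrite le_eqVlt; apply/orP; left; apply/eqP; field; rewrite gt_eqF//.
apply: ler_sum_nat => l /andP[ql _].
apply: lerXn2r; rewrite ?nnegrE ?rnorm_ge0 ?res_ge//.
exact: mulr_ge0 W0 (divr_ge0 (ltW t0) (ler0n _ 16)).
Qed.

End LowerBound.

Lemma prod_multiples_le (R : realType) (F : nat -> R) (d a b : nat) :
  (forall m, 1 <= F m) -> (0 < d)%N -> (a <= b)%N ->
  \prod_(a <= t < b) F (d * t)%N <= \prod_(d * a <= m < d * b) F m.
Proof.
move=> F1 d0; have F0 m : 0 <= F m by rewrite (le_trans ler01).
elim: b => [|b IHb]; first by rewrite leqn0 => /eqP ->; rewrite muln0 !big_geq.
rewrite leq_eqVlt ltnS => /predU1P[->|ab]; first by rewrite !big_geq.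
rewrite big_nat_recr//= [leRHS](big_cat_nat (n := d * b)%N) ?leq_mul2l ?ab ?leqnSn ?orbT//=.
apply: ler_pM => //; [exact: prodr_ge0|exact: IHb|].
rewrite big_ltn ?ltn_mul2l ?d0//= ler_peMr//.
by rewrite big_seq; elim/big_rec: _ => // m y _ y1; rewrite -[leLHS]mulr1 ler_pM.
Qed.

Lemma expR_le1D2 (R : realType) (w : R) : 0 <= w -> w <= 2^-1 -> expR w <= 1 + 2 * w.
Proof.
move=> w0 w2; have h : 1 - w <= expR (- w) by exact: expR_ge1Dx.
rewrite -[w in leLHS]opprK expRN.
apply: (@le_trans _ _ (1 - w)^-1); first by rewrite lef_pV2 ?posrE ?expR_gt0//; lra.
rewrite -[leLHS]mul1r ler_pdivrMr; last by lra.
nra.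
Qed.

Section LargeResolvent.
Variables (R : realType) (x : nat -> CC R).
Hypothesis x1 : forall m, rnorm (x m) = 1.
Hypothesis clustered :
  forall i m, (2 ^ i %| m)%N -> rnorm (x m - x 0%N) <= (2 ^+ i) ^- 2.

(** Let [dl = 4 ^- i] be the distance from [z] to [x 0]. At multiples of [2 ^ i] the pole has
    modulus at most [3 dl], so the squared step ratio is at least [1 + u] with [u = 1 / (9 N dl)],
    hence at least [exp (u / 2)]. The middle half of the indices contains [N / (2 * 2 ^ i)] such
    multiples; their product is [exp (2 ^ i / 36)], whose square root gives the constant 72. The
    exponent is thus of order [dl ^ (-1/2)]. *)
Lemma resolvent_large i : (0 < i)%N ->
  \forall k \near \oo, exists2 g,
    l2norm (level k) g <= 1 &
    expR (2 ^+ i / 72) / 32 <= l2norm (level k)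
      (resolvent (damping R k) x ((1 - (2 ^+ i) ^- 2)%:C%C * x 0%N) g).
Proof.
move=> i0; pose e : R := 2 ^+ i; pose dl := e ^- 2.
have e2 : 2 <= e by rewrite /e -[leLHS]expr1 ler_weXn2l ?ler1n.
have e0 : 0 < e by rewrite (lt_le_trans _ e2).
have dl0 : 0 < dl by rewrite invr_gt0 exprn_gt0.
have dl4 : dl <= 4^-1 by rewrite lef_pV2 ?posrE ?exprn_gt0//; nra.
set z := (_ * _ : CC R).
have zE : rnorm z = 1 - dl.
  by rewrite rnormM x1 mulr1 rnorm_real ger0_norm// -/e -/dl; lra.
near=> k.
have N0 := level_gt0 R k; have r01 := damping01 R k.
have Ndl : (level k)%:R^-1 <= dl / 2.
  by near: k; apply: level_inv_le; rewrite divr_gt0.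
have ik : (i.+1 <= k)%N by near: k; exact: nbhs_infty_ge.
pose q := (2 ^ k.-1)%N; pose a := (2 ^ (k.-1 - i))%N.
have kE : level k = (4 * q)%N.
  by rewrite /level /q -{1}(ltn_predK ik) 2!expnS mulnA.
have qE : q = (2 ^ i * a)%N.
  by rewrite /q /a -expnD subnKC// -ltnS (ltn_predK ik).
have z1 : rnorm z <= 1 by rewrite zE; lra.
have p0 l : pole (damping R k) x z l != 0.
  apply: pole_neq0 => //; rewrite zE /damping; apply/eqP; lra.
have Q1 m : 1 <= rnorm (stepratio (damping R k) x z m) by exact: stepratio_ge1.
have q0 : (0 < q)%N by rewrite expn_gt0.
have Nr : 1 <= (4 * q)%:R * (1 - damping R k ^+ 2) by rewrite -kE level_defect_ge.
have [g g1 gW] := resolvent_ge x1 r01 q0 z1 p0 Nr.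
exists g; first by rewrite kE.
rewrite kE ler_pdivrMr// [leRHS]mulrC (le_trans _ gW)//.
rewrite -(ler_pXn2r (n := 2))// ?nnegrE ?expR_ge0//; last first.
  by apply: prodr_ge0 => m _; exact: rnorm_ge0.
rewrite -prodrXl.
pose F m := rnorm (stepratio (damping R k) x z m) ^+ 2.
have F1 m : 1 <= F m by rewrite /F -[leLHS](expr1n _ 2) ler_pXn2r ?nnegrE ?rnorm_ge0.
have a3 : (a <= 3 * a)%N by rewrite -[leqLHS]mul1n leq_mul2r orbT.
have i2 : (0 < 2 ^ i)%N by rewrite expn_gt0.
have := prod_multiples_le F1 i2 a3; rewrite mulnCA -qE => h.
apply: le_trans h.
pose u := ((level k)%:R * (9 * dl))^-1.
have u0 : 0 < u by rewrite invr_gt0 !mulr_gt0.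
have u1 : u <= 1.
  have : 1 <= dl / 2 * (level k)%:R by rewrite -ler_pdivrMr// mul1r.
  rewrite /u invf_le1 ?mulr_gt0//.
  have : 0 < (level k)%:R * dl by rewrite mulr_gt0.
  lra.
have Fu t : expR (u / 2) <= F (2 ^ i * t)%N.
  set m := (_ * _)%N.
  have pm : rnorm (pole (damping R k) x z m) <= 3 * dl.
    have -> : pole (damping R k) x z m =
        - ((level k)%:R^-1)%:C%C * x m + (x m - x 0%N) + dl%:C%C * x 0%N.
      by rewrite /pole /damping /z -/e -/dl !rmorphB !rmorph1; ring.
    have t1 : rnorm (- ((level k)%:R^-1)%:C%C * x m) <= dl / 2.
      by rewrite rnormM x1 mulr1 rnormN rnorm_real gtr0_norm ?invr_gt0.
    have t2 : rnorm (dl%:C%C * x 0%N) = dl.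
      by rewrite rnormM x1 mulr1 rnorm_real gtr0_norm.
    have t3 : rnorm (x m - x 0%N) <= dl by apply: clustered; exact: dvdn_mulr.
    have := rnormD (- ((level k)%:R^-1)%:C%C * x m + (x m - x 0%N)) (dl%:C%C * x 0%N).
    have := rnormD (- ((level k)%:R^-1)%:C%C * x m) (x m - x 0%N).
    lra.
  have pm0 : 0 < rnorm (pole (damping R k) x z m).
    by rewrite lt_def rnorm_ge0 andbT; apply: contra_neq (p0 m) => /rnorm_eq0.
  rewrite /F (stepratio_sqr x1)// zE.
  have u2 : 0 <= u / 2 <= 2^-1 by lra.
  case/andP: u2 => u20 u21; apply: le_trans (expR_le1D2 u20 u21) _.
  rewrite mulrC divfK// lerD2l.
  have -> : u = (level k)%:R^-1 * dl / (3 * dl) ^+ 2.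
    by rewrite /u; field; rewrite !gt_eqF.
  have A1 : (level k)%:R^-1 <= 1 - damping R k ^+ 2.
    by rewrite -[leLHS]mul1r ler_pdivrMr// mulrC level_defect_ge.
  have A2 : dl <= 1 - (1 - dl) ^+ 2 by nra.
  have dl3 : 0 < 3 * dl by exact: mulr_gt0.
  have A3 : ((3 * dl) ^+ 2)^-1 <= (rnorm (pole (damping R k) x z m) ^+ 2)^-1.
    rewrite lef_pV2 ?posrE ?exprn_gt0//.
    by apply: lerXn2r; rewrite ?nnegrE ?rnorm_ge0 ?(ltW dl3).
  have Nv : 0 <= (level k)%:R^-1 :> R by rewrite invr_ge0.
  apply: ler_pM A3; first exact: mulr_ge0 Nv (ltW dl0).
    by rewrite invr_ge0 sqr_ge0.
  exact: ler_pM Nv (ltW dl0) A1 A2.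
apply: (@le_trans _ _ (\prod_(a <= t < 3 * a) expR (u / 2))); last first.
  by apply: ler_prod => t _; rewrite expR_ge0 Fu.
rewrite prodr_const_nat -!expRM_natl ler_expR.
have aR : a%:R != 0 :> R by rewrite pnatr_eq0 -lt0n expn_gt0.
rewrite /u kE qE !natrM natrX -/e (_ : (3 * a - a)%N = (2 * a)%N); last first.
  by rewrite -[X in (_ - X)%N]mul1n -mulnBl.
rewrite natrM /dl le_eqVlt; apply/orP; left; apply/eqP; field.
by rewrite aR gt_eqF.
Unshelve. all: by end_near. Qed.

End LargeResolvent.

(** * A 2-adically clustered sequence of condensation points *)

Lemma countable_setU (T : Type) (A B : set T) :
  countable A -> countable B -> countable (A `|` B).
Proof.
move=> cA cB; rewrite (_ : A `|` B = \bigcup_b (if b then A else B)).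
  by apply: bigcup_countable => [|[]//]; exact: countableP.
rewrite eqEsubset; split=> [y [Ay|By]|y [[] _ ?]];
  by [exists true|exists false|left|right].
Qed.

Section Condensation.
Variables (R : realType) (E : set (CC R)).

Definition disc (c : CC R) (e : R) : set (CC R) := [set y | rnorm (y - c) < e].

Definition condensation : set (CC R) :=
  [set y | E y /\ forall e, 0 < e -> ~ countable (E `&` disc y e)].

Lemma rational_near (y : CC R) (e : R) : 0 < e ->
  exists a b : rat, disc ((ratr a) +i* (ratr b))%C e y.
Proof.
move=> e0; case: y => u v.
have e2 : 0 < e / 2 by rewrite divr_gt0.
have [a /andP[au ua]] : exists a : rat, u - e / 2 < ratr a < u + e / 2.
  have [|a] := @rat_in_itvoo R (u - e / 2) (u + e / 2); first by lra.
  by rewrite in_itv/= => ?; exists a.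
have [b /andP[bv vb]] : exists b : rat, v - e / 2 < ratr b < v + e / 2.
  have [|b] := @rat_in_itvoo R (v - e / 2) (v + e / 2); first by lra.
  by rewrite in_itv/= => ?; exists b.
exists a, b; rewrite /disc /=.
rewrite -(ltr_pXn2r (n := 2))// ?nnegrE ?rnorm_ge0 ?(ltW e0)// rnorm_sqr /=.
have ha : (u - ratr a) ^+ 2 < (e / 2) ^+ 2 by nra.
have hb : (v - ratr b) ^+ 2 < (e / 2) ^+ 2 by nra.
have he : (e / 2) ^+ 2 = e ^+ 2 / 4 by field.
have e20 : 0 < e ^+ 2 by rewrite exprn_gt0.
rewrite (lt_trans (ltrD ha hb))// he -mulr2n -mulr_natl; lra.
Qed.

(** A point of [E] that is not a condensation point lies in a disc with rational centre and radius
    [1 / n.+1] that meets [E] in a countable set, and there are countably many such discs. *)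
Lemma countable_not_condensation : countable (E `\` condensation).
Proof.
pose B (t : rat * rat * nat) := disc ((ratr t.1.1) +i* (ratr t.1.2))%C (t.2.+1%:R^-1).
pose I := [set t | countable (E `&` B t)].
apply: (@sub_countable _ _ _ (\bigcup_(t in I) (E `&` B t))); last first.
  by apply: bigcup_countable => //; exact: countableP.
apply: subset_card_le => y [Ey nc].
have [e [e0 ce]] : exists e, 0 < e /\ countable (E `&` disc y e).
  apply: contrapT => h; apply: nc; split=> // e e0 ce; apply: h; by exists e.
have [n _ /(_ n (leqnn n)) /= ne] := near_infty_natSinv_lt (PosNum (divr_gt0 e0 (ltr0n R 2))).
have n0 : 0 < (n.+1%:R^-1 : R) by rewrite invr_gt0.
have [a [b yab]] := rational_near y n0.
exists (a, b, n) => //.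
apply: sub_countable ce; apply: subset_card_le => w [Ew wab]; split=> //.
move: yab wab; rewrite /B /disc /=; set c := (_ +i* _)%C => yc wc.
have := rnormD (w - c) (c - y); rewrite subrKA (rdistC c) => /le_lt_trans; apply.
by rewrite (splitr e); exact: ltrD (lt_trans wc ne) (lt_trans yc ne).
Qed.

Lemma uncountable_condensation (A : set (CC R)) : A `<=` E ->
  ~ countable A -> ~ countable (A `&` condensation).
Proof.
move=> AE nA cA; apply: nA.
apply: (@sub_countable _ _ _ ((A `&` condensation) `|` (E `\` condensation))).
  apply: subset_card_le => y Ay.
  by have [yc|yc] := pselect (condensation y); [left|right; split=> //; exact: AE].
exact: countable_setU cA countable_not_condensation.
Qed.

(** Every disc around [y] contains uncountably many points of [E], of which only countably many are
    not condensation points. *)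
Lemma condensation_perfect y e : condensation y -> 0 < e ->
  exists2 w, condensation w & w != y /\ rnorm (w - y) <= e.
Proof.
move=> [Ey yc] e0; apply: contrapT => h.
apply: (uncountable_condensation (@subIsetl _ E (disc y e)) (yc e e0)).
apply: (@sub_countable _ _ _ [set y]); last exact: countable1.
apply: subset_card_le => w [[Ew wy] wc] /=.
have [//|wny] := eqVneq w y.
by exfalso; apply: h; exists w => //; split => //; rewrite ltW.
Qed.

Lemma condensation_exists : ~ countable E -> exists y, condensation y.
Proof.
move=> nE; apply: contrapT => h.
apply: (uncountable_condensation (@subset_refl _ E) nE).
rewrite (_ : _ `&` _ = set0) ?countable0// -subset0 => y [_ yc].
by apply: h; exists y.
Qed.

End Condensation.

(** Course-of-values recursion: each term is chosen from the list of all earlier ones. *)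
Lemma prefix_recursion (T : Type) (f : seq T -> T) :
  exists x : nat -> T, forall n, x n = f (mkseq x n).
Proof.
pose fix s n := if n is n'.+1 then rcons (s n') (f (s n')) else [::].
exists (fun n => f (s n)) => n; congr f.
by elim: n => [//|n IHn] /=; rewrite mkseqS -IHn.
Qed.

(** Removes the leading binary digit of [n]. Iterating it leads from [n] to [n %% 2 ^ i] without
    leaving the class of [n] modulo [2 ^ i]. *)
Definition parent n := (n - 2 ^ trunc_log 2 n)%N.

Lemma parent_lt n : (0 < n)%N -> (parent n < n)%N.
Proof. by move=> n0; rewrite /parent ltn_subrL expn_gt0 n0. Qed.

Lemma parent_mod i n : (2 ^ i <= n)%N -> parent n = n %[mod 2 ^ i].
Proof.
move=> iN; have n0 : (0 < n)%N by rewrite (leq_trans _ iN)// expn_gt0.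
have il : (i <= trunc_log 2 n)%N by exact: trunc_log_max.
have /eqP dt : (2 ^ i %| 2 ^ trunc_log 2 n)%N by exact: dvdn_exp2l.
by rewrite -[in RHS](subnK (trunc_logP (isT : (1 < 2)%N) n0)) -modnDmr dt addn0.
Qed.

Section ClusteredSequence.
Variables (R : realType) (E : set (CC R)).
Hypothesis E_uncountable : ~ countable E.

Lemma spaced_seq (s : seq (CC R)) : exists2 e : R, 0 < e <= 1 &
  forall a b, a \in s -> b \in s -> a != b -> e <= rnorm (a - b).
Proof.
have near_seq c : forall s : seq (CC R), exists2 e : R, 0 < e <= 1 &
    forall a, a \in s -> a != c -> e <= rnorm (a - c).
  elim=> [|b s' [e /andP[e0 e1] es]]; first by exists 1; rewrite ?ltr01 ?lexx.
  have [->|bc] := eqVneq b c.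
    exists e; first by rewrite e0.
    by move=> a; rewrite inE => /predU1P[->|/es//]; rewrite eqxx.
  have bc0 : 0 < rnorm (b - c).
    by rewrite lt_def rnorm_ge0 andbT; apply: contra_neq bc => /rnorm_eq0/subr0_eq.
  exists (Num.min e (rnorm (b - c))); first by rewrite lt_min e0 bc0 ge_min e1.
  move=> a; rewrite inE => /predU1P[->|/es h] ac; rewrite ge_min ?lexx ?orbT//.
  by rewrite h.
elim: s => [|c s [e /andP[e0 e1] es]]; first by exists 1; rewrite ?ltr01 ?lexx.
have [d /andP[d0 d1] ds] := near_seq c s.
exists (Num.min e d); first by rewrite lt_min e0 d0 ge_min e1.
move=> a b; rewrite !inE => /predU1P[->|sa] /predU1P[->|sb].
- by rewrite eqxx.
- by move=> cb; rewrite rdistC ge_min ds ?orbT// eq_sym.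
- by move=> ac; rewrite ge_min ds ?orbT.
- by move=> ab; rewrite ge_min es.
Qed.

(** Put [x n] so close to [x (parent n)] that, summed along the chain of parents, the displacements
    stay small against the distances between earlier terms. Then [x m] stays near [x (m %% 2 ^ i)]:
    distinct classes remain apart and each class is clustered. *)
Lemma clustered_sequence : exists x : nat -> CC R,
  [/\ forall m, E (x m),
      forall i, exists2 d : R, 0 < d &
        forall m m', m != m' %[mod 2 ^ i] -> d <= rnorm (x m - x m') &
      forall i m, (2 ^ i %| m)%N -> rnorm (x m - x 0%N) <= (2 ^+ i) ^- 2].
Proof.
have [y0 y0c] := condensation_exists E_uncountable.
(* The list [s] is arbitrary at this stage, so the requirement is conditional on the parent being a
   condensation point; this holds along the sequence by induction. *)
pose next (s : seq (CC R)) (y : CC R) :=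
  if s is [::] then condensation E y else
  let p := nth y0 s (parent (size s)) in
  condensation E p -> [/\ condensation E y, y != p, rnorm (y - p) <= 4 ^- (size s).+1 &
    forall a b, a \in s -> b \in s -> a != b ->
      rnorm (y - p) <= 4 ^- (size s).+1 * rnorm (a - b)].
have /choice [f fP] : forall s, exists y, next s y.
  move=> s; rewrite /next; case: s => [|h s]; first by exists y0.
  set p := nth _ _ _; have [pc|pc] := pselect (condensation E p); last by exists y0.
  have [e /andP[e0 e1] es] := spaced_seq (h :: s).
  pose d : R := 4 ^- (size (h :: s)).+1.
  have d0 : 0 < d by rewrite invr_gt0 exprn_gt0.
  have [w wc [wp we]] := condensation_perfect pc (mulr_gt0 d0 e0).
  exists w => _; split => //; first by rewrite (le_trans we)// ler_piMr// ltW.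
  by move=> a b sa sb ab; rewrite (le_trans we)// ler_wpM2l ?(ltW d0)// es.
have [x xP] := prefix_recursion f.
have x0c : condensation E (x 0%N) by rewrite xP; exact: (fP [::]).
have nextP n : (0 < n)%N -> condensation E (x (parent n)) ->
    [/\ condensation E (x n), x n != x (parent n),
      rnorm (x n - x (parent n)) <= 4 ^- n.+1 &
      forall a b, (a < n)%N -> (b < n)%N -> x a != x b ->
      rnorm (x n - x (parent n)) <= 4 ^- n.+1 * rnorm (x a - x b)].
  move=> n0; have := fP (mkseq x n); rewrite -xP /next.
  have : size (mkseq x n) = n by rewrite size_mkseq.
  have sn : forall a, (a < n)%N -> x a \in mkseq x n.
    by move=> a an; apply/mapP; exists a; rewrite ?mem_iota.
  have pn : nth y0 (mkseq x n) (parent n) = x (parent n).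
    by rewrite nth_mkseq// parent_lt.
  move: sn pn; case: (mkseq x n) => [_ _ /= n00|h s sn pn ->].
    by rewrite -n00 in n0.
  rewrite pn => H /H [xc xp xd xs]; split => // a b an bn ab.
  by apply: xs; rewrite ?sn.
have xc n : condensation E (x n).
  elim/ltn_ind: n => -[//|n] IHn.
  by have [] := nextP n.+1 isT (IHn _ (parent_lt _)).
(* If [x n = x m] with [m] different from the parent, the rule for the pair [m], [parent n] bounds
   their distance by [4 ^- n.+1] times itself. *)
have xinj n m : (m < n)%N -> x m != x n.
  elim/ltn_ind: n m => n IHn m mn.
  have n0 : (0 < n)%N by exact: leq_ltn_trans mn.
  have [_ xp _ xd] := nextP n n0 (xc _).
  have [->|mp] := eqVneq m (parent n); first by rewrite eq_sym.
  apply/eqP => xmn.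
  have mp' : x m != x (parent n).
    move: mp; rewrite neq_ltn => /orP[mp|mp]; first by rewrite IHn// parent_lt.
    by rewrite eq_sym IHn.
  have := xd _ _ mn (parent_lt n0) mp'; rewrite -xmn.
  have : 0 < rnorm (x m - x (parent n)).
    by rewrite lt_def rnorm_ge0 andbT; apply: contra_neq mp' => /rnorm_eq0/subr0_eq.
  have : 4 ^- n.+1 < 1 :> R by rewrite invf_lt1 ?exprn_gt0// exprn_egt1// ltr1n.
  nra.
(* Indices strictly decrease along the parents, so the displacements sum to at most [D] times the
   series of [4 ^- n.+1] over [n >= 2 ^ i], which is [4 ^- (2 ^ i) / 3]. *)
have chain i (D : R) : 0 <= D ->
    (forall n, (2 ^ i <= n)%N -> rnorm (x n - x (parent n)) <= 4 ^- n.+1 * D) ->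
    forall m, rnorm (x m - x (m %% 2 ^ i)%N) <= D * 4 ^- (2 ^ i) / 3.
  move=> D0 Dn m.
  have le4 a b : (a <= b)%N -> 4 ^- b <= 4 ^- a :> R.
    by move=> ab; rewrite lef_pV2 ?posrE ?exprn_gt0// ler_weXn2l// ler1n.
  have S4 a : 4 ^- a = 4 * 4 ^- a.+1 :> R by rewrite exprS invfM mulrA divff ?mul1r.
  have pos4 a : 0 < 4 ^- a :> R by rewrite invr_gt0 exprn_gt0.
  suff : (2 ^ i <= m)%N ->
      rnorm (x m - x (m %% 2 ^ i)%N) <= D * (4 ^- (2 ^ i) - 4 ^- m.+1) / 3.
    have [im /(_ isT)|mi _] := leqP (2 ^ i)%N m.
      by have := mulr_ge0 D0 (ltW (pos4 m.+1)); lra.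
    by rewrite modn_small// subrr rnorm0; have := mulr_ge0 D0 (ltW (pos4 (2 ^ i)%N)); lra.
  elim/ltn_ind: m => m IHm im.
  have m0 : (0 < m)%N by rewrite (leq_trans _ im)// expn_gt0.
  have := rnormD (x m - x (parent m)) (x (parent m) - x (m %% 2 ^ i)%N).
  rewrite subrKA => /le_trans; apply.
  have pm := parent_lt m0; have mm := parent_mod im.
  have Dm := Dn m im.
  have [ip|ip] := leqP (2 ^ i)%N (parent m).
    have := IHm _ pm ip; rewrite mm.
    have := ler_wpM2l D0 (le4 _ _ pm); rewrite (S4 m); lra.
  have pE : parent m = (m %% 2 ^ i)%N by rewrite -mm modn_small.
  rewrite pE in Dm *; rewrite subrr rnorm0 addr0.
  have := ler_wpM2l D0 (le4 _ _ im); rewrite (S4 m); lra.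
exists x; split.
- by move=> m; have [] := xc m.
- move=> i.
  have [e /andP[e0 _] es] := spaced_seq (mkseq x (2 ^ i)).
  exists (e / 3); first by rewrite divr_gt0.
  move=> m m' mm'.
  set a := (m %% 2 ^ i)%N; set b := (m' %% 2 ^ i)%N.
  have ai : (a < 2 ^ i)%N by rewrite ltn_mod expn_gt0.
  have bi : (b < 2 ^ i)%N by rewrite ltn_mod expn_gt0.
  have ab : x a != x b.
    by move: mm'; rewrite -/a -/b neq_ltn => /orP[|] /xinj //; rewrite eq_sym.
  have mem c : (c < 2 ^ i)%N -> x c \in mkseq x (2 ^ i).
    by move=> ci; apply/mapP; exists c; rewrite ?mem_iota.
  have eab : e <= rnorm (x a - x b) by rewrite es ?mem.
  (* Each of the two points moves by at most [D / 3] from its residue, which leaves a distance of at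
     least [D / 3]. *)
  pose D := rnorm (x a - x b).
  have D0 : 0 <= D by exact: rnorm_ge0.
  have DP n : (2 ^ i <= n)%N -> rnorm (x n - x (parent n)) <= 4 ^- n.+1 * D.
    move=> iN; have n0 : (0 < n)%N by rewrite (leq_trans _ iN)// expn_gt0.
    by have [_ _ _] := nextP n n0 (xc _); apply => //; exact: leq_trans iN.
  have p4 : 4 ^- (2 ^ i) <= 1 :> R.
    by rewrite invf_le1 ?exprn_gt0// exprn_ege1// ler1n.
  have := chain i D D0 DP m; have := chain i D D0 DP m'; rewrite -/a -/b.
  have := rnormD (x a - x m) (x m - x m').
  have := rnormD (x a - x m') (x m' - x b).
  rewrite !subrKA (rdistC (x a) (x m)) -/D; nra.
- move=> i m /eqP im.
  have DP n : (2 ^ i <= n)%N -> rnorm (x n - x (parent n)) <= 4 ^- n.+1 * 1.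
    move=> iN; have n0 : (0 < n)%N by rewrite (leq_trans _ iN)// expn_gt0.
    by rewrite mulr1; have [] := nextP n n0 (xc _).
  have := chain i 1 ler01 DP m; rewrite im mul1r => /le_trans; apply.
  have : 4 ^- (2 ^ i) <= (2 ^+ i) ^- 2 :> R.
    rewrite -exprM mulnC exprM lef_pV2 ?posrE ?exprn_gt0//.
    rewrite (_ : 2 ^+ 2 = 4); last by rewrite -natrX.
    by rewrite ler_weXn2l ?ler1n// ltnW// ltn_expl.
  have : 0 < 4 ^- (2 ^ i) :> R by rewrite invr_gt0 exprn_gt0.
  lra.
Qed.

End ClusteredSequence.

(** * The operator on the hull *)

Section OperatorNorm.
Variables (R : realType) (V : completeNormedModType (CC R)).
Implicit Types (T : V -> V) (v : V).

Lemma bounded_op_le T c : 0 <= c -> linear T ->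
  (forall v, rnorm (T v) <= c * rnorm v) -> bounded_op T.
Proof.
move=> c0 Tl Tc; split=> //; apply/ex_bound; exists (c%:C%C); near=> v => /=.
rewrite -rnorm_le (le_trans (Tc v))// ler_piMr// rnorm_le; near: v.
by apply: nbhs0_le; rewrite ltcR.
Unshelve. all: by end_near. Qed.

Lemma opnorm_ge0 T : 0 <= opnorm T.
Proof.
rewrite /opnorm; set A := [set _ | _ in _].
(* By convention [sup] is 0 on a set without supremum. *)
have [Asup|/sup_out->//] := pselect (has_sup A).
apply: (@le_trans _ _ (rnorm (T 0))); first exact: rnorm_ge0.
by apply: ub_le_sup; [case: Asup|exists 0; rewrite /= ?normr0].
Qed.

Lemma opnorm_le T c : 0 <= c -> (forall v, rnorm (T v) <= c * rnorm v) ->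
  opnorm T <= c.
Proof.
move=> c0 Tc; apply: ge_sup.
  by exists (rnorm (T 0)); exists 0; rewrite /= ?normr0.
move=> _ [v /= v1 <-]; rewrite -/(rnorm (T v)) (le_trans (Tc v))// ler_piMr//.
by rewrite rnorm_le.
Qed.

(** The bound by [c] makes the set defining [opnorm] bounded above, so that [opnorm T] is its true
    supremum. *)
Lemma le_opnorm T c v : linear T -> (forall v, rnorm (T v) <= c * rnorm v) ->
  rnorm (T v) <= opnorm T * rnorm v.
Proof.
move=> Tl Tc.
have T0 : T 0 = 0.
  by have := Tl (-1) 0 0; rewrite scaleN1r oppr0 addr0 scaleN1r addrC subrr.
have [v0|v0] := eqVneq (rnorm v) 0.
  by rewrite (rnorm_eq0 v0) T0 rnorm0 mulr0.
have vp : 0 < rnorm v by rewrite lt_def v0 rnorm_ge0.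
pose a : CC R := ((rnorm v)^-1)%:C%C.
have ra : rnorm a = (rnorm v)^-1 by rewrite rnorm_real gtr0_norm ?invr_gt0.
have Ta : T (a *: v) = a *: T v by have := Tl a v 0; rewrite !addr0 T0 addr0.
rewrite -ler_pdivrMr// mulrC -ra -rnormZ -Ta.
apply: ub_le_sup.
  exists `|c| => _ [w /= w1 <-]; rewrite -/(rnorm (T w)) (le_trans (Tc w))//.
  rewrite (le_trans (ler_wpM2r (rnorm_ge0 w) (ler_norm c)))// ler_piMr//.
  by rewrite rnorm_le.
by exists (a *: v) => //=; rewrite -[1]/(1%:C)%C -rnorm_le rnormZ ra mulVf.
Qed.

End OperatorNorm.

Section HullOperatorTheory.
Variables (R : realType) (U : lmodType (CC R)) (p : seminorms U).
Local Notation hull := (hull p).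
Implicit Types (x : hull) (T S : nat -> U -> U).

Lemma hull_map_near T S c d x : ubounded p T c -> ubounded p S d ->
  (\forall k \near \oo, T k =1 S k) -> hull_map T x = hull_map S x.
Proof.
move=> Tc Sd TS.
have Tb := ubounded_sbounded Tc (valP (hrep x)).
have Sb := ubounded_sbounded Sd (valP (hrep x)).
rewrite /hull_map (mkhullE Tb) (mkhullE Sb); apply/hcls_eq => e e0 /=.
near=> k; have -> : T k (val (hrep x) k) = S k (val (hrep x) k) by near: k; apply: filterS TS.
by rewrite subrr sn0 ltW.
Unshelve. all: by end_near. Qed.

Lemma ubounded_id : ubounded p (fun k => id) 1.
Proof. by split=> //; apply: nearW => k u; rewrite mul1r. Qed.

Lemma ubounded_comp T S c d : 0 <= c -> ubounded p T c -> ubounded p S d ->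
  ubounded p (fun k => T k \o S k) (c * d).
Proof.
move=> c0 [Tl Tc] [Sl Sd]; split=> [k a u v|]; first by rewrite /= Sl Tl.
near=> k => u /=; rewrite -mulrA.
have Tk : forall w, p k (T k w) <= c * p k w by near: k.
have Sk : forall w, p k (S k w) <= d * p k w by near: k.
by rewrite (le_trans (Tk _))// ler_wpM2l.
Unshelve. all: by end_near. Qed.

Lemma ubounded_iter T c n : 0 <= c -> ubounded p T c ->
  ubounded p (fun k => iter n (T k)) (c ^+ n).
Proof.
move=> c0 Tc; elim: n => [|n IHn]; first exact: ubounded_id.
by rewrite exprS; exact: (ubounded_comp c0 Tc IHn).
Qed.

Lemma hull_map_iter T c n x : 0 <= c -> ubounded p T c ->
  iter n (hull_map T) x = hull_map (fun k => iter n (T k)) x.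
Proof.
move=> c0 Tc; elim: n => [|n IHn]; first by rewrite hull_map_id.
rewrite iterS IHn (hull_map_comp _ Tc (ubounded_iter n c0 Tc)).
by congr hull_map.
Qed.

Lemma ubounded_shift T c z : ubounded p T c ->
  ubounded p (fun k u => T k u - z *: u) (c + rnorm z).
Proof.
move=> [Tl Tc]; split=> [k a u v|].
  by rewrite Tl scalerBr scalerDr opprD addrACA !scalerA mulrC.
near=> k => u; rewrite (le_trans (snB p _ _ _))// snZ mulrDl lerD2r.
by move: u; near: k.
Unshelve. all: by end_near. Qed.

Lemma hull_map_shift T c z x : ubounded p T c ->
  hull_map (fun k u => T k u - z *: u) x = hull_map T x - z *: x.
Proof.
move=> Tc; have xb := valP (hrep x); have Tx := ubounded_sbounded Tc xb.
rewrite addrC -scaleNr -{2}[x]mkhull_repr /hull_map -(mkhull_linear (- z) xb Tx).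
by congr mkhull; apply/funext => k; rewrite addrC scaleNr.
Qed.

Lemma bounded_op_hull_map T c : 0 <= c -> ubounded p T c ->
  bounded_op (hull_map T : hull -> hull).
Proof.
move=> c0 Tc; apply: (bounded_op_le c0 (hull_map_linear Tc)) => x.
exact: hull_map_le Tc c0.
Qed.

Lemma bounded_inverse_hull_map T S c d z : 0 <= d -> ubounded p T c ->
  ubounded p S d ->
  (\forall k \near \oo, (forall u, S k (T k u - z *: u) = u) /\
                        (forall u, T k (S k u) - z *: S k u = u)) ->
  bounded_inverse (fun x : hull => hull_map T x - z *: x) (hull_map S).
Proof.
move=> d0 Tc Sd TS; have Tz := ubounded_shift z Tc.
(* Composition of bounds needs a nonnegative constant, and [c] has no prescribed sign, hence the
   absolute value. *)
have cz0 : 0 <= `|c + rnorm z| by [].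
have Tz' : ubounded p (fun k u => T k u - z *: u) `|c + rnorm z|.
  split; first by case: Tz.
  near=> k => u; rewrite (@le_trans _ _ ((c + rnorm z) * p k u))//.
    by move: u; near: k; case: Tz.
  by rewrite ler_wpM2r ?sn_ge0// ler_norm.
split; first exact: bounded_op_hull_map Sd.
- move=> x /=; rewrite -(hull_map_shift z x Tc) (hull_map_comp _ Sd Tz').
  rewrite (hull_map_near _ (ubounded_comp d0 Sd Tz') ubounded_id) ?hull_map_id//.
  by apply: filterS TS => k [] + _ u /=; exact.
- move=> x /=; rewrite -(hull_map_shift z _ Tc) (hull_map_comp _ Tz' Sd).
  rewrite (hull_map_near _ (ubounded_comp cz0 Tz' Sd) ubounded_id) ?hull_map_id//.
  by apply: filterS TS => k [] _ + u /=; exact.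
Unshelve. all: by end_near. Qed.

End HullOperatorTheory.

(** * The counterexample and its failure of polynomial growth *)

Lemma poly_lt_expR (R : realType) (K : R) (n : nat) :
  exists y0 : R, forall y, y0 < y -> K * y ^+ n < expR (y / 72).
Proof.
pose c : R := 72 * n.+1%:R; have c0 : 0 < c by rewrite mulr_gt0.
exists (Num.max 0 (K * c ^+ n.+1)) => y; rewrite gt_max => /andP[y0 yK].
have yc : 0 < y / c by rewrite divr_gt0.
have h : (y / c) ^+ n.+1 <= expR (y / 72).
  have -> : y / 72 = n.+1%:R * (y / c).
    have : n.+1%:R != 0 :> R by rewrite pnatr_eq0.
    by rewrite /c; move: (n.+1%:R : R) => N N0; field; rewrite N0.
  rewrite expRM_natl; apply: lerXn2r; rewrite ?nnegrE ?expR_ge0 ?(ltW yc)//.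
  by rewrite (le_trans _ (expR_ge1Dx _))// lerDr.
apply: lt_le_trans h; rewrite expr_div_n exprS mulrAC.
by rewrite ltr_pM2r ?exprn_gt0// ltr_pdivlMr ?exprn_gt0.
Qed.

Section Counterexample.
Variables (R : realType) (x : nat -> CC R).
Hypothesis x1 : forall m, rnorm (x m) = 1.
Local Notation p := (l2seminorms R level).
Local Notation T := (fun k => cayley (damping R k) x).
Local Notation res z := (fun k => resolvent (damping R k) x z).

Lemma ubounded_cayley : ubounded p T 1.
Proof.
split=> [k|]; first exact: cayley_linear.
apply: nearW => k u; rewrite mul1r.
exact: cayley_contraction (damping01 R k) _ _.
Qed.

Lemma ubounded_resolvent z d : 0 < d -> (forall l, d <= rnorm (x l - z)) ->
  exists c, [/\ 0 <= c, ubounded p (res z) c &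
    bounded_inverse (fun v : hull p => hull_map T v - z *: v) (hull_map (res z))].
Proof.
move=> d0 dx; have [c [c0 cP]] := resolvent_bounded x1 d0 dx.
have Rc : ubounded p (res z) c.
  split=> [k|]; first exact: resolvent_linear.
  by apply: filterS cP => k [].
exists c; split=> //.
apply: (bounded_inverse_hull_map c0 ubounded_cayley Rc).
apply: filterS cP => k [p0 _]; split=> u; first exact: cayleyK.
exact: resolventK.
Qed.

Lemma ubounded_inverse : exists c, [/\ 0 <= c, ubounded p (res 0) c &
  bounded_inverse (hull_map T : hull p -> hull p) (hull_map (res 0))].
Proof.
have [|c [c0 Rc Rinv]] := @ubounded_resolvent 0 1 ltr01.
  by move=> l; rewrite subr0 x1.
exists c; split=> //; have -> : hull_map T = fun v : hull p => hull_map T v - 0 *: v => //.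
by apply/funext => v; rewrite scale0r subr0.
Qed.

Lemma opnorm_cayley n : opnorm (iter n (hull_map T : hull p -> hull p)) <= 1.
Proof.
apply: opnorm_le => // v; rewrite (hull_map_iter _ _ ler01 ubounded_cayley).
have := ubounded_iter n ler01 ubounded_cayley; rewrite expr1n => Tn.
exact: hull_map_le.
Qed.

Hypothesis separated : forall i, exists2 d : R, 0 < d &
  forall m m', m != m' %[mod 2 ^ i] -> d <= rnorm (x m - x m').

Lemma opnorm_inverse (eps : R) : 0 < eps -> exists C, forall n,
  opnorm (iter n.+1 (hull_map (res 0) : hull p -> hull p)) <=
  C * expR (eps * Num.sqrt n.+1%:R).
Proof.
move=> e0; have [C [C0 CP]] := inverse_growth x1 separated e0.
exists C => n; have CE : 0 <= C * expR (eps * Num.sqrt n.+1%:R).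
  by rewrite mulr_ge0 ?expR_ge0.
have [c [c0 Rc _]] := ubounded_inverse.
apply: opnorm_le => // v; rewrite (hull_map_iter _ _ c0 Rc).
apply: hull_map_le => //; split; last exact: CP.
by case: (ubounded_iter n.+1 c0 Rc).
Qed.

Hypothesis clustered :
  forall i m, (2 ^ i %| m)%N -> rnorm (x m - x 0%N) <= (2 ^+ i) ^- 2.

(** At [z = (1 - dl) x 0] with [dl = e ^- 2], [e = 2 ^ i], some [w = (T - z)^-1 v] with [|v| <= 1]
    has norm at least [exp (e / 72) / 32]. Iterating [w = A v + z A w] gives a sum of [M = e ^ 4]
    terms [A ^ j.+1 v] plus a remainder. Under polynomial growth the sum is polynomial in [e] and
    the remainder at most [|w| / 2], a contradiction for large [i]. *)
Lemma opnorm_inverse_not_poly (q : nat) (C : R) :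
  ~ forall n, opnorm (iter n (hull_map (res 0) : hull p -> hull p)) <=
      C * n.+1%:R ^+ q.
Proof.
have half_le (b c X Y : R) : b <= c -> X <= Y -> 64 * c < X -> 0 < Y ->
  b <= Y * 2^-1 by lra.
have absurd (c X W S W' : R) : 64 * c < X -> X / 32 <= W -> S <= c ->
  W' <= 2^-1 * W -> W <= S + W' -> False by lra.
pose A : hull p -> hull p := hull_map (res 0).
pose a n := opnorm (iter n A).
rewrite -/A => an; have [c [c0 Rc [_ AT TA]]] := ubounded_inverse.
rewrite -/A in AT TA.
have aP n v : rnorm (iter n A v) <= a n * rnorm v.
  apply: (le_opnorm (c := c ^+ n)) => [|w]; rewrite /A.
    have -> : iter n A = hull_map (fun k => iter n (res 0 k)).
      by apply/funext => w; exact: hull_map_iter Rc.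
    exact: hull_map_linear (ubounded_iter n c0 Rc).
  rewrite (hull_map_iter _ _ c0 Rc).
  by apply: hull_map_le; [exact: ubounded_iter|exact: exprn_ge0].
pose C1 := Num.max 1 C; have C10 : 0 < C1 by rewrite lt_max ltr01.
have aC n : a n <= C1 * n.+1%:R ^+ q.
  by rewrite (le_trans (an n))// ler_wpM2r ?exprn_ge0// le_max lexx orbT.
(* Chosen so that [K * e ^+ (4 * q.+1)] is 64 times the bound [e ^+ 4 * B] on the sum of [M]
   terms. *)
pose K : R := 64 * C1 * 2 ^+ q; have K0 : 0 < K by rewrite !mulr_gt0 ?exprn_gt0.
have [y0 y0P] := poly_lt_expR K (4 * q.+1).
have [i [i0 yi]] : exists i, (0 < i)%N /\ y0 < 2 ^+ i.
  exists (Num.truncn (Num.max 0 y0)).+1; split=> //.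
  have h : y0 < (Num.truncn (Num.max 0 y0)).+1%:R.
    by rewrite (le_lt_trans _ (truncnS_gt _))// le_max lexx orbT.
  by rewrite (lt_trans h)// -natrX ltr_nat ltn_expl.
have := y0P _ yi; set e : R := 2 ^+ i => Ke.
have e1 : 1 <= e by rewrite exprn_ege1// ler1n.
have e0 : 0 < e by rewrite (lt_le_trans ltr01).
pose dl := e ^- 2; have dl0 : 0 < dl by rewrite invr_gt0 exprn_gt0.
have dl1 : dl <= 1 by rewrite invf_le1 ?exprn_gt0// exprn_ege1.
pose z : CC R := (1 - dl)%:C%C * x 0%N.
have zE : rnorm z = 1 - dl.
  by rewrite rnormM x1 mulr1 rnorm_real ger0_norm// subr_ge0.
have [|d [d0 Rd [_ RT TR]]] := @ubounded_resolvent z dl dl0.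
  move=> l; have := rnorm_distB (x l) z; rewrite x1 zE; lra.
(* At the finitely many levels where a good test vector may be missing, 0 is taken; the class of the
   family does not see them. *)
have gex k : exists g : nat -> CC R, l2norm (level k) g <= 1 /\
    ((exists2 g, l2norm (level k) g <= 1 & expR (e / 72) / 32 <=
      l2norm (level k) (res z k g)) -> expR (e / 72) / 32 <=
      l2norm (level k) (res z k g)).
  have [[g g1 gR]|ng] := pselect (exists2 g, l2norm (level k) g <= 1 &
    expR (e / 72) / 32 <= l2norm (level k) (res z k g)); first by exists g.
  exists 0; split=> //; rewrite (_ : l2norm _ _ = 0)//.
  by rewrite -[X in l2norm _ X](scale0r 0) l2normZ rnorm0 mul0r.
have [g gP] := choice gex.
have gb : g \in sbounded p.
  by apply/asboolP; exists 1; apply: nearW => k; case: (gP k).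
pose v := mkhull p g; pose w := hull_map (res z) v.
have v1 : rnorm v <= 1 by apply: mkhull_le; apply: nearW => k; case: (gP k).
have w_ge : expR (e / 72) / 32 <= rnorm w.
  rewrite /w /v (hull_mapE Rd gb); apply: mkhull_ge.
    exact: ubounded_sbounded Rd gb.
  have := resolvent_large x1 clustered i0; apply: filterS => k.
  by case: (gP k) => _; exact.
have wE : w = A v + z *: A w.
  have Al : linear A by exact: hull_map_linear Rc.
  have -> : A v = - z *: A w + w.
    by rewrite -[X in _ + X]AT -Al addrC scaleNr TR.
  by rewrite addrAC scaleNr addNr add0r.
have Aw n : rnorm (iter n A w) <= rnorm (iter n.+1 A v) + rnorm z * rnorm (iter n.+1 A w).
  suff -> : iter n A w = iter n.+1 A v + z *: iter n.+1 A w by rewrite -rnormZ rnormD.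
  have Al : linear A by exact: hull_map_linear Rc.
  elim: n => [|n IHn]; first exact: wE.
  transitivity (A (iter n.+1 A v + z *: iter n.+1 A w)); first by rewrite -IHn.
  rewrite (addrC (iter n.+1 A v)) Al; exact: addrC.
have w_le M : rnorm w <= \sum_(j < M) rnorm (iter j.+1 A v) +
    rnorm z ^+ M * rnorm (iter M A w).
  elim: M => [|M IHM]; first by rewrite big_ord0 add0r expr0 mul1r.
  rewrite (le_trans IHM)// big_ord_recr/= -addrA lerD2l exprSr -mulrA.
  rewrite (le_trans (ler_wpM2l _ (Aw M))) ?exprn_ge0 ?rnorm_ge0//.
  rewrite mulrDr lerD2r ler_piMl ?rnorm_ge0// exprn_ile1 ?rnorm_ge0// zE.
  by rewrite gerBl ltW.
(* With this [M], [|z| ^ M <= exp (- M * dl) = exp (- e ^ 2)], which beats the polynomial bound on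
   [a M]. *)
have [M ME] : exists M : nat, M%:R = e ^+ 4.
  by exists (2 ^ (4 * i))%N; rewrite natrX /e -exprM mulnC.
have M0 : (0 < M)%N by rewrite -(ltr0n R) ME exprn_gt0.
have Mq n : (n <= M)%N -> a n <= C1 * 2 ^+ q * e ^+ (4 * q).
  move=> nM; rewrite (le_trans (aC n))// -mulrA ler_wpM2l ?(ltW C10)//.
  rewrite exprM -exprMn; apply: lerXn2r; rewrite ?nnegrE ?mulr_ge0 ?exprn_ge0 ?(ltW e0)//.
  by rewrite -ME -natrM ler_nat mul2n -addnn -addn1 leq_add.
pose B := C1 * 2 ^+ q * e ^+ (4 * q).
have B0 : 0 < B by rewrite !mulr_gt0 ?exprn_gt0.
have sum_le : \sum_(j < M) rnorm (iter j.+1 A v) <= e ^+ 4 * B.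
  have jB (j : 'I_M) : rnorm (iter j.+1 A v) <= B.
    apply: le_trans (aP _ _) _.
    apply: le_trans (ler_wpM2r (rnorm_ge0 v) (Mq j.+1 (ltn_ord j))) _.
    exact: ler_piMr (ltW B0) v1.
  apply: (@le_trans _ _ (\sum_(j < M) B)); first by apply: ler_sum => j _; exact: jB.
  by rewrite sumr_const card_ord -[leLHS]mulr_natl ME.
have KB : K * e ^+ (4 * q.+1) = 64 * (e ^+ 4 * B).
  by rewrite mulnS exprD /K /B; ring.
rewrite KB in Ke.
have e41 : 1 <= e ^+ 4 by rewrite exprn_ege1.
have tail_le : rnorm z ^+ M * a M <= 2^-1.
  apply: (@le_trans _ _ (expR (- e ^+ 2) * B)).
    apply: (@le_trans _ _ (rnorm z ^+ M * B)).
      by rewrite ler_wpM2l ?exprn_ge0 ?rnorm_ge0// Mq.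
    rewrite ler_wpM2r ?(ltW B0)// zE.
    have -> : - e ^+ 2 = M%:R * - dl.
      by rewrite ME /dl; field; rewrite gt_eqF.
    rewrite expRM_natl; apply: lerXn2r; rewrite ?nnegrE ?expR_ge0 ?subr_ge0//.
    exact: expR_ge1Dx.
  rewrite expRN ler_pdivrMl ?expR_gt0//.
  have ee : expR (e / 72) <= expR (e ^+ 2).
    rewrite ler_expR (@le_trans _ _ e)//; last by rewrite expr2 ler_peMr// ltW.
    by rewrite ler_pdivrMr// ler_peMr ?(ltW e0)// ler1n.
  have Be : B <= e ^+ 4 * B by rewrite ler_peMl// ltW.
  exact: half_le Be ee Ke (expR_gt0 _).
have Aw_le : rnorm z ^+ M * rnorm (iter M A w) <= 2^-1 * rnorm w.
  apply: le_trans (ler_wpM2r (rnorm_ge0 w) tail_le).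
  by rewrite -mulrA ler_wpM2l ?exprn_ge0 ?rnorm_ge0.
exact: absurd Ke w_ge sum_le Aw_le (w_le M).
Qed.

End Counterexample.

Theorem proposition5p4 (R : realType) (E : set (CC R))
    (E_circle : E `<=` unit_circle) (E_closed : closed E)
    (E_uncountable : ~ countable E) (t : R) (t_ge0 : 0 <= t) :
  ~ property_P 0 t E.
Proof.
have [x [xE separated clustered]] := clustered_sequence E_uncountable.
have x1 m : rnorm (x m) = 1 by rewrite /rnorm (E_circle _ (xE m)).
have [c [c0 Rc Ainv]] := ubounded_inverse x1.
pose T : hull (l2seminorms R level) -> _ :=
  hull_map (fun k => cayley (damping R k) x).
pose A : hull (l2seminorms R level) -> _ :=
  hull_map (fun k => resolvent (damping R k) x 0).
move=> /(_ (hull (l2seminorms R level)) T A).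
have Tb : bounded_op T by exact: bounded_op_hull_map ler01 (ubounded_cayley x1).
have spec : spectrum T `<=` E.
  move=> z zT; apply: contrapT => zE; apply: zT.
  (* A point outside the closed set [E] has positive distance to it, hence to all points of [x]. *)
  have [d d0 dP] : exists2 d : R, 0 < d & forall y, E y -> d <= rnorm (y - z).
    have [_ /posC_real[d d0 ->] dE] :=
      (nbhs_ballP _ _).1 (open_nbhs_nbhs (conj (closed_openC E_closed) zE)).
    exists d => // y Ey; rewrite leNgt; apply/negP => yz.
    by apply: (dE y) Ey; rewrite -ball_normE /= -rnorm_lt rdistC.
  have [c' [_ _ inv]] := ubounded_resolvent x1 d0 (fun l => dP _ (xE l)).
  by exists (hull_map (fun k => resolvent (damping R k) x z)).
move=> /(_ Tb Ainv spec).
have TO : (fun n : nat => opnorm (iter n T)) =O_\oo (fun n : nat => n%:R `^ 0).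
  apply/eqO_exP; exists 1 => //; apply: nearW => n.
  rewrite powRr0 normr1 mulr1 ger0_norm ?opnorm_ge0//.
  exact: opnorm_cayley.
move=> /(_ TO).
have AO (eps : R) : 0 < eps -> (fun n : nat => opnorm (iter n A)) =O_\oo
    (fun n : nat => expR (eps * Num.sqrt n%:R)).
  move=> eps0; have [C CP] := opnorm_inverse x1 separated eps0.
  apply/eqO_exP; exists (Num.max 1 C); first by rewrite lt_max ltr01.
  exists 1%N => // -[//|n] _.
  rewrite !ger0_norm ?opnorm_ge0 ?expR_ge0// (le_trans (CP n))//.
  by rewrite ler_wpM2r ?expR_ge0// le_max lexx orbT.
move=> /(_ AO) /eqO_exP[C C0 [n0 _ n0P]].
pose q := (Num.truncn t).+1.
have tq : t <= q%:R by rewrite ltW// truncnS_gt.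
(* The finitely many initial norms are added to the constant, so that the bound holds for every [n];
   the real power [t] is replaced by the integer [q], with base [n.+1] to stay at least 1. *)
pose C' := C + \sum_(j < n0) opnorm (iter j A).
apply: (opnorm_inverse_not_poly x1 clustered (q := q) (C := C')) => n.
rewrite -/A.
have nq : 1 <= n.+1%:R ^+ q :> R by rewrite exprn_ege1// ler1n.
have S0 : 0 <= \sum_(j < n0) opnorm (iter j A).
  by apply: sumr_ge0 => j _; exact: opnorm_ge0.
have [nn|nn] := ltnP n n0.
  apply: (@le_trans _ _ C').
    rewrite /C' (bigD1 (Ordinal nn))//= addrCA lerDl addr_ge0 ?(ltW C0)//.
    by apply: sumr_ge0 => j _; exact: opnorm_ge0.
  by rewrite ler_peMr// addr_ge0// ltW.
have := n0P n nn; rewrite /= ger0_norm ?opnorm_ge0// => /le_trans; apply.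
rewrite ger0_norm ?powR_ge0//.
apply: (@le_trans _ _ (C * n.+1%:R ^+ q)).
  rewrite ler_wpM2l ?(ltW C0)//.
  apply: (@le_trans _ _ (n.+1%:R `^ t)); first by rewrite ge0_ler_powR ?nnegrE ?ler_nat.
  by rewrite -powR_mulrn// ler_powR// ler1n.
by rewrite ler_wpM2r ?exprn_ge0// lerDl.
Qed.
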